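(* Consider the problem $\min_{x\in X}\max_{y\in Y}F(x,y)$ under the standing assumptions in the context, let $\varepsilon_x>0$, and set $$\varepsilon_y=\frac{\varepsilon_x^2}{L_{xx}R_y}.$$ Then Algorithm D (defined in the context), run with this $\varepsilon_y$ and the parameter values specified in the context, produces a point $\hat x\in X$ (the primal component of its output) that satisfies $\|\nabla\varphi_{2L_{xx}}(\hat x)\|=O(\varepsilon_x)$, in $$\widetilde O\left(\frac{\Delta\,L_{xx}^{3/2}\,(L_{yy}^+)^{1/2}R_y}{\varepsilon_x^3}\right)$$ oracle calls (computations of $\nabla F$).
   Context: Standing assumptions. $X$ and $Y$ are convex sets with non-empty interior in Euclidean spaces $\mathcal X,\mathcal Y$, onto which Euclidean projection is computationally cheap; $Y$ is compact and contained in a Euclidean ball of radius $R_y<\infty$. $\|\cdot\|$, $\langle\cdot,\cdot\rangle$ are the Euclidean norm and inner product, and $[T]:=\{1,\dots,T\}$ for a positive integer $T$. The function $F:X\times Y\to\mathbb R$ is concave in $y$ for every $x\in X$ (not necessarily convex in $x$) and has partial gradients $\nabla_xF,\nabla_yF$ (the components of the full gradient $\nabla F$) satisfying, for all $x,x'\in X$, $y,y'\in Y$, with Lipschitz constants $L_{xx},L_{yy},L_{xy}$: $\|\nabla_xF(x',y)-\nabla_xF(x,y)\|\le L_{xx}\|x'-x\|$, $\|\nabla_yF(x,y')-\nabla_yF(x,y)\|\le L_{yy}\|y'-y\|$, $\|\nabla_xF(x,y')-\nabla_xF(x,y)\|\le L_{xy}\|y'-y\|$, $\|\nabla_yF(x',y)-\nabla_yF(x,y)\|\le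 L_{xy}\|x'-x\|$. Primal function and its Moreau envelope: $\varphi(x):=\max_{y\in Y}F(x,y)$, $\varphi_{2L_{xx}}(x):=\min_{x'\in X}[\varphi(x')+L_{xx}\|x'-x\|^2]$. Primal gap: $\Delta:=\varphi(x_0)-\min_{x\in X}\varphi(x)$, with $x_0\in X$ the initial iterate. $L_{yy}^+:=L_{yy}+L_{xy}^2/L_{xx}$. Convention: $O(\cdot)$ hides a generic constant, and $\widetilde O(\cdot)$ hides in addition logarithmic factors in the complexity factors $T_x:=L_{xx}\Delta/\varepsilon_x^2$ and $T_y:=\sqrt{L_{yy}^+R_y/\varepsilon_y}$. Algorithms. Prox-mapping: $\mathrm{prox}_{z,Z}(\zeta):=\arg\min_{z'\in Z}\langle\zeta,z'\rangle+\frac12\|z'-z\|^2$. Algorithm A, $\mathrm{FGM}(z_0,Z,\gamma,T,g(\cdot))$, where $g$ is a (possibly inexact) gradient oracle: set $G_0=0$; for $t=0,1,\dots,T-1$ do: $u_t=\mathrm{prox}_{z_0,Z}(\gamma G_t)$; $\tau_t=\frac{2(t+2)}{(t+1)(t+4)}$; $v_{t+1}=\tau_tu_t+(1-\tau_t)z_t$; $g_t=\frac{t+2}{2}g(v_{t+1})$; $w_{t+1}=\mathrm{prox}_{u_t,Z}(\gamma g_t)$; $z_{t+1}=\tau_tw_{t+1}+(1-\tau_t)z_t$; $G_{t+1}=G_t+g_t$. Return $z_T$. Algorithm B, $\mathrm{RestartFGM}(z^0,Z,\gamma,T,S,g(\cdot))$: for $s=1,\dots,S$ set $z^s=\mathrm{FGM}(z^{s-1},Z,\gamma,T,g(\cdot))$.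 Return $z^S$. Algorithm C, $\mathrm{SolveRegDual}(y,x_{t-1},\bar y,\gamma_x,\lambda_y,T,S)$: compute $\tilde x_t(y)=\mathrm{RestartFGM}\big(x_{t-1},X,\tfrac23\gamma_x,T,S,\ \nabla_xF(\cdot,y)+\tfrac1{\gamma_x}(\cdot-x_{t-1})\big)$ and $\tilde\nabla\psi_t(y)=\nabla_yF(\tilde x_t(y),y)-\lambda_y(y-\bar y)$. Return $\tilde x_t(y),\tilde\nabla\psi_t(y)$. Algorithm D, with initial points $x_0\in X$, $\bar y\in Y$: for $t=1,\dots,\overline T_x$ do: (i) $y_t=\mathrm{RestartFGM}(\bar y,Y,\gamma_y,\overline T_y,S_y,-\tilde\nabla\psi_t(\cdot))$, where each value $\tilde\nabla\psi_t(y)$ is the one returned by $\mathrm{SolveRegDual}(y,x_{t-1},\bar y,\gamma_x,\lambda_y,T^o,S^o)$; (ii) $x_t=\tilde x_t(y_t)$, returned by $\mathrm{SolveRegDual}(y_t,x_{t-1},\bar y,\gamma_x,\lambda_y,T^o,S^o)$. Output $(x_\tau,y_\tau)$ with $\tau\in\mathrm{Argmin}_{t\in[\overline T_x]}\|\nabla_xF(x_t,y_t)\|$. Parameters: $\lambda_y=\varepsilon_y/R_y$, $\Theta=L_{yy}R_y^2$, $\Theta^+=L_{yy}^+R_y^2$, $\gamma_x=\frac1{2L_{xx}}$, $\gamma_y=\frac1{L_{yy}^++\lambda_y}$, $T^o=11$, and $\overline T_x,\overline T_y,S_y,S^o$ are the smallest positive integers with $\overline T_x\ge 10L_{xx}(\Delta+2\varepsilon_yR_y)/\varepsilon_x^2$,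 $\overline T_y\ge\sqrt{40(L_{yy}^++\lambda_y)/\lambda_y}$, $S_y\ge2\log_2(\max[\overline T_y,\Theta^+/\delta])$, $S^o\ge\frac12\log_2\big(72(3\Delta+2\Theta+6\varepsilon_yR_y)\big[\frac{L_{xx}}{\varepsilon_x^2}+\frac{2\Theta^+}{\delta^2}+\frac1{12\delta}\big]\big)$, where $\delta=\min\big[8\varepsilon_yR_y,\ \Theta/(2\overline T_y^3),\ \sqrt{\Delta(\Theta^+-\Theta)/(\overline T_x\overline T_y^2)}\big]$.
   Formalization: If X is not the whole space, τ minimizes a stationarity residual instead of ‖∇_xF(x_t,y_t)‖; Δ and the Lipschitz constants are positive; the bound has factors max(1,1/T_x), max(1,1/T_y), and Õ also hides logs of L_yy^+/L_yy and L_yy^+/(L_yy^+−L_yy). *)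

(* Defs.v *)
(* Real analysis over an abstract realType (MathComp-Analysis). *)
From mathcomp Require Import all_boot all_order all_algebra.
From mathcomp Require Import all_classical all_reals all_analysis.
Import Order.TTheory GRing.Theory Num.Theory.
Import numFieldNormedType.Exports.

Set Implicit Arguments.
Unset Strict Implicit.
Unset Printing Implicit Defensive.

Local Open Scope classical_set_scope.
Local Open Scope ring_scope.

(* The library norm on row vectors is the sup norm, which induces the same
   topology as the Euclidean norm but not the same Lipschitz constants. *)
Definition dot {R : realType} {n : nat} (u v : 'rV[R]_n) : R :=
  \sum_(i < n) u 0 i * v 0 i.

Definition enorm {R : realType} {n : nat} (u : 'rV[R]_n) : R :=
  Num.sqrt (dot u u).

(* g is a gradient of f at x relative to D (one-sided at boundary points);
   it is unique when D is convex with non-empty interior, and it is the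
   ordinary gradient when D = setT. *)
Definition is_grad {R : realType} {n : nat} (D : set 'rV[R]_n)
    (f : 'rV[R]_n -> R) (x g : 'rV[R]_n) : Prop :=
  forall e : R, 0 < e -> \forall z \near within D (nbhs x),
    `|f z - f x - dot g (z - x)| <= e * enorm (z - x).

Record minimax (R : realType) (n m : nat) := Minimax {
  dX : set 'rV[R]_n;
  dY : set 'rV[R]_m;
  obj : 'rV[R]_n -> 'rV[R]_m -> R;
  gradx : 'rV[R]_n -> 'rV[R]_m -> 'rV[R]_n;
  grady : 'rV[R]_n -> 'rV[R]_m -> 'rV[R]_m;
  Lxx : R;
  Lyy : R;
  Lxy : R;
  Ry : R
}.

Definition Lyyp {R : realType} {n m : nat} (P : minimax R n m) : R :=
  Lyy P + Lxy P ^+ 2 / Lxx P.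

Definition primal {R : realType} {n m : nat} (P : minimax R n m)
    (x : 'rV[R]_n) : R :=
  sup [set obj P x y | y in dY P].

(* phi_mu (x) = min_{x' in X} phi(x') + (mu / 2) |x' - x|^2, for every x in
   the whole space. *)
Definition moreau {R : realType} {n m : nat} (P : minimax R n m) (mu : R)
    (x : 'rV[R]_n) : R :=
  inf [set primal P x' + mu / 2 * enorm (x' - x) ^+ 2 | x' in dX P].

Definition primal_gap {R : realType} {n m : nat} (P : minimax R n m)
    (x0 : 'rV[R]_n) : R :=
  primal P x0 - inf [set primal P x | x in dX P].

(* Closedness of X is what makes Euclidean projections onto X exist, and the
   lower bound on the primal function is what makes the primal gap finite.
   The constants are positive: the step sizes and the accuracy delta of the
   algorithm divide by them. *)
Record standing {R : realType} {n m : nat} (P : minimax R n m) : Prop := {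
  X_convex : convex_set (dX P);
  X_closed : closed (dX P);
  X_interior : (dX P)° !=set0;
  Y_convex : convex_set (dY P);
  Y_compact : compact (dY P);
  Y_interior : (dY P)° !=set0;
  Ry_gt0 : 0 < Ry P;
  Y_ball : exists c : 'rV[R]_m, forall y, dY P y -> enorm (y - c) <= Ry P;
  Lxx_gt0 : 0 < Lxx P;
  Lyy_gt0 : 0 < Lyy P;
  Lxy_gt0 : 0 < Lxy P;
  obj_concave : forall x, dX P x ->
    convex_function (dY P) (fun y => - obj P x y);
  gradx_grad : forall x y, dX P x -> dY P y ->
    is_grad (dX P) (obj P ^~ y) x (gradx P x y);
  grady_grad : forall x y, dX P x -> dY P y ->
    is_grad (dY P) (obj P x) y (grady P x y);
  gradx_lipx : forall x x' y, dX P x -> dX P x' -> dY P y ->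
    enorm (gradx P x' y - gradx P x y) <= Lxx P * enorm (x' - x);
  grady_lipy : forall x y y', dX P x -> dY P y -> dY P y' ->
    enorm (grady P x y' - grady P x y) <= Lyy P * enorm (y' - y);
  gradx_lipy : forall x y y', dX P x -> dY P y -> dY P y' ->
    enorm (gradx P x y' - gradx P x y) <= Lxy P * enorm (y' - y);
  grady_lipx : forall x x' y, dX P x -> dX P x' -> dY P y ->
    enorm (grady P x' y - grady P x y) <= Lxy P * enorm (x' - x);
  primal_bounded : has_lbound [set primal P x | x in dX P]
}.

Definition prox {R : realType} {n : nat} (z : 'rV[R]_n) (Z : set 'rV[R]_n)
    (zeta : 'rV[R]_n) : 'rV[R]_n :=
  let h z' := dot zeta z' + 2^-1 * enorm (z' - z) ^+ 2 in
  xget z [set p | Z p /\ forall z', Z z' -> h p <= h z'].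

(* Every procedure below returns, as its last component, the number of
   computations of the gradient of F it performs; accordingly an oracle
   returns a vector together with the cost of the query. *)
Definition oracle (R : realType) (n : nat) := 'rV[R]_n -> 'rV[R]_n * nat.

(* One iteration, from (z_t, G_t, cost) to (z_{t+1}, G_{t+1}, cost). *)
Definition fgm_step {R : realType} {n : nat} (z0 : 'rV[R]_n)
    (Z : set 'rV[R]_n) (gam : R) (g : oracle R n) (t : nat)
    (st : 'rV[R]_n * 'rV[R]_n * nat) : 'rV[R]_n * 'rV[R]_n * nat :=
  let: (z, G, c) := st in
  let u := prox z0 Z (gam *: G) in
  let tau : R := (2 * (t + 2))%:R / ((t + 1) * (t + 4))%:R in
  let v := tau *: u + (1 - tau) *: z in
  let: (gv, cv) := g v in
  let gt := ((t + 2)%:R / 2) *: gv in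
  let w := prox u Z (gam *: gt) in
  (tau *: w + (1 - tau) *: z, G + gt, (c + cv)%N).

Fixpoint fgm_iter {R : realType} {n : nat} (z0 : 'rV[R]_n)
    (Z : set 'rV[R]_n) (gam : R) (g : oracle R n) (t : nat) :
    'rV[R]_n * 'rV[R]_n * nat :=
  if t is s.+1 then fgm_step z0 Z gam g s (fgm_iter z0 Z gam g s)
  else (z0, 0, 0%N).

Definition fgm {R : realType} {n : nat} (z0 : 'rV[R]_n)
    (Z : set 'rV[R]_n) (gam : R) (T : nat) (g : oracle R n) :
    'rV[R]_n * nat :=
  let: (z, _, c) := fgm_iter z0 Z gam g T in (z, c).

Fixpoint restart_fgm {R : realType} {n : nat} (z0 : 'rV[R]_n)
    (Z : set 'rV[R]_n) (gam : R) (T S : nat) (g : oracle R n) :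
    'rV[R]_n * nat :=
  if S is s.+1 then
    let: (zs, c) := restart_fgm z0 Z gam T s g in
    let: (z, c') := fgm zs Z gam T g in (z, (c + c')%N)
  else (z0, 0%N).

(* Returns (x~_t(y), the inexact gradient of psi_t at y, cost). *)
Definition solve_reg_dual {R : realType} {n m : nat} (P : minimax R n m)
    (y : 'rV[R]_m) (xprev : 'rV[R]_n) (ybar : 'rV[R]_m)
    (gamx lamy : R) (T S : nat) : 'rV[R]_n * 'rV[R]_m * nat :=
  let: (x, c) := restart_fgm xprev (dX P) (2 / 3 * gamx) T S
    (fun x => (gradx P x y + gamx^-1 *: (x - xprev), 1%N)) in
  (x, grady P x y - lamy *: (y - ybar), (c + 1)%N).

Record parameters (R : realType) := AlgParams {
  lam_y : R;
  gam_x : R;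
  gam_y : R;
  nTx : nat;
  nTy : nat;
  nSy : nat;
  nTo : nat;
  nSo : nat
}.

(* Smallest positive integer k with r <= k. *)
Definition least_posint {R : realType} (r : R) : nat :=
  absz (Num.max 1 (Num.ceil r)).

Definition log2 {R : realType} (r : R) : R := ln r / ln 2.

Definition std_parameters {R : realType} {n m : nat} (P : minimax R n m)
    (x0 : 'rV[R]_n) (epsx epsy : R) : parameters R :=
  let Delta := primal_gap P x0 in
  let lamy := epsy / Ry P in
  let Theta := Lyy P * Ry P ^+ 2 in
  let Thetap := Lyyp P * Ry P ^+ 2 in
  let Tx := least_posint (10 * Lxx P * (Delta + 2 * epsy * Ry P) / epsx ^+ 2) in
  let Ty := least_posint (Num.sqrt (40 * (Lyyp P + lamy) / lamy)) in
  let delta := Num.min (8 * epsy * Ry P)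
    (Num.min (Theta / (2 * Ty%:R ^+ 3))
       (Num.sqrt (Delta * (Thetap - Theta) / (Tx%:R * Ty%:R ^+ 2)))) in
  let Sy := least_posint (2 * log2 (Num.max Ty%:R (Thetap / delta))) in
  let So := least_posint (1 / 2 * log2
    (72 * (3 * Delta + 2 * Theta + 6 * epsy * Ry P) *
     (Lxx P / epsx ^+ 2 + 2 * Thetap / delta ^+ 2 + 1 / (12 * delta)))) in
  {| lam_y := lamy;
     gam_x := 1 / (2 * Lxx P);
     gam_y := 1 / (Lyyp P + lamy);
     nTx := Tx; nTy := Ty; nSy := Sy; nTo := 11; nSo := So |}.

(* (x_t, y_t, cost of the first t outer iterations); for t = 0 the second
   component is a dummy. *)
Fixpoint outer_iter {R : realType} {n m : nat} (P : minimax R n m)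
    (q : parameters R) (x0 : 'rV[R]_n) (ybar : 'rV[R]_m) (t : nat) :
    'rV[R]_n * 'rV[R]_m * nat :=
  if t is s.+1 then
    let: (xprev, _, c) := outer_iter P q x0 ybar s in
    let solve y :=
      solve_reg_dual P y xprev ybar (gam_x q) (lam_y q) (nTo q) (nSo q) in
    let: (yt, cy) := restart_fgm ybar (dY P) (gam_y q) (nTy q) (nSy q)
      (fun y => let: (_, gpsi, cs) := solve y in (- gpsi, cs)) in
    let: (xt, _, cx) := solve yt in
    (xt, yt, (c + cy + cx)%N)
  else (x0, ybar, 0%N).

Definition iter_x {R : realType} {n m : nat} (P : minimax R n m)
    (q : parameters R) (x0 : 'rV[R]_n) (ybar : 'rV[R]_m) (t : nat) : 'rV[R]_n :=
  (outer_iter P q x0 ybar t).1.1.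

Definition iter_y {R : realType} {n m : nat} (P : minimax R n m)
    (q : parameters R) (x0 : 'rV[R]_n) (ybar : 'rV[R]_m) (t : nat) : 'rV[R]_m :=
  (outer_iter P q x0 ybar t).1.2.

(* Besides the outer iterations, selecting the output uses the gradient of F
   once at each (x_t, y_t). *)
Definition oracle_calls {R : realType} {n m : nat} (P : minimax R n m)
    (q : parameters R) (x0 : 'rV[R]_n) (ybar : 'rV[R]_m) : nat :=
  ((outer_iter P q x0 ybar (nTx q)).2 + nTx q)%N.

Definition argmin_upto {R : realType} (T : nat) (crit : nat -> R) (tau : nat) :=
  (1 <= tau <= T)%N /\ forall t, (1 <= t <= T)%N -> crit tau <= crit t.

(* Stationarity residual of the point x under the constraint X:
     S_X(x, xi, L)^2 = 2 L max_{x' in X} [- <xi, x' - x> - (L/2) |x' - x|^2].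
   It equals |xi| when X is the whole space. When X has a boundary, |xi|
   does not measure stationarity, since the gradient need not vanish at a
   constrained minimizer. *)
Definition residual {R : realType} {n : nat} (X : set 'rV[R]_n)
    (x xi : 'rV[R]_n) (L : R) : R :=
  Num.sqrt (2 * L *
    sup [set - dot xi (x' - x) - L / 2 * enorm (x' - x) ^+ 2 | x' in X]).

(* x_tau is an admissible output: tau minimizes |grad_x F(x_t, y_t)| when X is
   the whole space, and in general it minimizes the stationarity residual that
   extends this norm to constrained X. *)
Definition is_output {R : realType} {n m : nat} (P : minimax R n m)
    (q : parameters R) (x0 : 'rV[R]_n) (ybar : 'rV[R]_m) (tau : nat) : Prop :=
  let x := iter_x P q x0 ybar in
  let g t := gradx P (x t) (iter_y P q x0 ybar t) in
  (dX P = setT /\ argmin_upto (nTx q) (fun t => enorm (g t)) tau) \/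
  argmin_upto (nTx q) (fun t => residual (dX P) (x t) (g t) (Lxx P)) tau.

(* The complexity factors. *)
Definition cplx_x {R : realType} {n m : nat} (P : minimax R n m)
    (x0 : 'rV[R]_n) (epsx : R) : R :=
  Lxx P * primal_gap P x0 / epsx ^+ 2.

Definition cplx_y {R : realType} {n m : nat} (P : minimax R n m)
    (epsy : R) : R :=
  Num.sqrt (Lyyp P * Ry P / epsy).

(* Logarithms hidden by the soft-O. The last two are needed because S_y and
   S^o grow with log (1 / delta), and delta tends to 0 when Lyy / Lyyp tends
   to 0 or to 1 with both complexity factors fixed. *)
Definition log_factor {R : realType} {n m : nat} (P : minimax R n m)
    (x0 : 'rV[R]_n) (epsx epsy : R) : R :=
  1 + `|ln (cplx_x P x0 epsx)| + `|ln (cplx_y P epsy)|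
    + ln (Lyyp P / Lyy P) + ln (Lyyp P / (Lyyp P - Lyy P)).

(* Main.v *)
Require Import Defs.
From mathcomp Require Import all_boot all_order all_algebra.
From mathcomp Require Import all_classical all_reals all_analysis.
From mathcomp Require Import ring lra.
Import Order.TTheory GRing.Theory Num.Theory.
Import numFieldNormedType.Exports.

Set Implicit Arguments.
Unset Strict Implicit.
Unset Printing Implicit Defensive.

Local Open Scope classical_set_scope.
Local Open Scope ring_scope.

(** Write E = epsx ^ 2 / Lxx = epsy Ry, so that lam_y Ry ^ 2 = E, and let phi
    be the primal function. One outer iteration from c = x_(t-1) regularizes F
    into F(x, y) + Lxx |x - c|^2, which is Lxx-strongly convex and
    3 Lxx-smooth in x. Its dual function in y is smooth with constant Lyyp
    ([ndual_lb], [ndual_ub]), and the term in lam_y makes it lam_y-strongly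
    concave.

    The fast gradient method is analysed with an estimate sequence in which the
    error of the oracle is only paired with differences of feasible points and
    does not accumulate ([fgm_iter_inv], [fgm_rate]). With the prescribed
    numbers of steps each restart divides the gap by 8 ([restart_rate]). For
    the inner solver this is better than the factor 4 for which the number of
    restarts is set. The margin is needed: Lxx / 2 times the squared distance from
    c to the inner solution is only bounded by
    phi(c) - inf phi + Theta^+ - Theta ([regmin_dist]), and Ry times the error of
    the dual gradient must be at most of order E / Ty ^ 2, where Ty is the number
    of steps of a stage ([inner_accuracy]).

    Hence ([accurate_step]) phi(x_t) <= F(x_t, y_t) + 7 E, and x_t minimizes
    the regularized problem at y_t up to E. Comparing with x_(t-1),
    phi(x_t) + Lxx |x_t - x_(t-1)|^2 <= phi(x_(t-1)) + 8 E. As there are more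
    than 10 Delta / E steps, some step is short, Lxx |x_t - x_(t-1)|^2 <= 9 E
    ([short_step]), and there the stationarity residual of x_t is O(epsx); the
    residual of the output is no larger. Finally, if xp is the proximal point
    of the output xhat, strong convexity of phi + Lxx |. - xhat|^2, the
    inequality phi(xhat) <= F(xhat, yhat) + 7 E and the bound on the residual
    give Lxx |xhat - xp|^2 = O(E), while 2 Lxx (xhat - xp) is the gradient of
    the Moreau envelope ([moreau_grad], [output_envelope]).

    For the complexity, the numbers of steps Tx and Ty are at most constant
    multiples of the complexity factors, truncated below at 1, whose product is
    the leading term ([leading_factor]). The numbers of restarts are logarithms
    of quantities polynomial in exp of the logarithmic factor. *)

(** * Euclidean geometry of row vectors *)

Section Euclid.
Context {R : realType} {n : nat}.
Implicit Types (u v w : 'rV[R]_n) (a : R).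

Lemma dotC u v : dot u v = dot v u.
Proof. by apply: eq_bigr => i _; rewrite mulrC. Qed.

Lemma dotDl u v w : dot (u + v) w = dot u w + dot v w.
Proof. by rewrite -big_split; apply: eq_bigr => i _; rewrite mxE mulrDl. Qed.

Lemma dotZl a u v : dot (a *: u) v = a * dot u v.
Proof. by rewrite mulr_sumr; apply: eq_bigr => i _; rewrite mxE mulrA. Qed.

Lemma dotDr u v w : dot u (v + w) = dot u v + dot u w.
Proof. by rewrite dotC dotDl !(dotC u). Qed.

Lemma dotZr a u v : dot u (a *: v) = a * dot u v.
Proof. by rewrite dotC dotZl dotC. Qed.

Lemma dotNl u v : dot (- u) v = - dot u v.
Proof. by rewrite -scaleN1r dotZl mulN1r. Qed.

Lemma dotNr u v : dot u (- v) = - dot u v.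
Proof. by rewrite dotC dotNl dotC. Qed.

Lemma dot0l v : dot 0 v = 0.
Proof. by rewrite -(scale0r v) dotZl mul0r. Qed.

Lemma dot0r v : dot v 0 = 0.
Proof. by rewrite dotC dot0l. Qed.

Definition dotE := (dotDl, dotDr, dotNl, dotNr, dotZl, dotZr).

Lemma dotBB u v w z :
  dot (u - v) (w - z) = dot u w - dot u z + dot v (z - w).
Proof. by rewrite !dotE; ring. Qed.

Lemma dot_ge0 u : 0 <= dot u u.
Proof. by apply: sumr_ge0 => i _; rewrite -expr2 sqr_ge0. Qed.

Lemma enorm_ge0 u : 0 <= enorm u.
Proof. exact: sqrtr_ge0. Qed.

Lemma enorm2 u : enorm u ^+ 2 = dot u u.
Proof. exact: sqr_sqrtr (dot_ge0 u). Qed.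

Lemma enorm0 : enorm (0 : 'rV[R]_n) = 0.
Proof. by rewrite /enorm dot0l sqrtr0. Qed.

Lemma enormN u : enorm (- u) = enorm u.
Proof. by rewrite /enorm dotNl dotNr opprK. Qed.

Lemma enormB u v : enorm (u - v) = enorm (v - u).
Proof. by rewrite -opprB enormN. Qed.

Lemma enormZ a u : enorm (a *: u) = `|a| * enorm u.
Proof.
by rewrite /enorm dotZl dotZr mulrA -expr2 sqrtrM ?sqr_ge0// sqrtr_sqr.
Qed.

Lemma dot_eq0 u : dot u u = 0 -> u = 0.
Proof.
move=> /eqP; rewrite psumr_eq0 => [/allP h|i _]; last by rewrite -expr2 sqr_ge0.
apply/rowP => i; rewrite mxE; have /h := mem_index_enum i.
by rewrite mulf_eq0 orbb => /eqP.
Qed.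

Lemma cauchy_schwarz u v : `|dot u v| <= enorm u * enorm v.
Proof.
rewrite -(@ler_pXn2r _ 2)// ?nnegrE ?mulr_ge0 ?enorm_ge0//.
rewrite exprMn !enorm2 real_normK ?num_real//.
have [/dot_eq0->|v0] := eqVneq (dot v v) 0.
  by rewrite dot0r expr0n/= mulr_ge0// dot_ge0.
have vp : 0 < dot v v by rewrite lt_neqAle eq_sym v0 dot_ge0.
have := dot_ge0 (dot v v *: u - dot u v *: v).
rewrite !dotE (dotC v u) => h.
have : 0 <= dot v v * (dot u u * dot v v - dot u v ^+ 2).
  by apply: le_trans h _; rewrite le_eqVlt; apply/orP; left; apply/eqP; ring.
by rewrite pmulr_rge0// subr_ge0.
Qed.

Lemma dot_le u v : dot u v <= enorm u * enorm v.
Proof. exact: le_trans (ler_norm _) (cauchy_schwarz u v). Qed.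

Lemma dot_ge u v : - (enorm u * enorm v) <= dot u v.
Proof. by rewrite lerNl -dotNl -(enormN u) dot_le. Qed.

Lemma enormD u v : enorm (u + v) <= enorm u + enorm v.
Proof.
rewrite -(@ler_pXn2r _ 2)// ?nnegrE ?addr_ge0 ?enorm_ge0//.
rewrite sqrrD !enorm2 !dotE (dotC v u).
by have := dot_le u v; lra.
Qed.

Lemma enorm_sub_le u v w : enorm (u - v) <= enorm (u - w) + enorm (v - w).
Proof. by rewrite (enormB v w); apply: le_trans (enormD _ _); rewrite subrKA. Qed.

Lemma mxnorm_le_enorm u : `|u| <= enorm u.
Proof.
rewrite [`|u|]mx_normrE; apply/bigmax_leP; split=> [|[i j] _ /=]; first exact: enorm_ge0.
rewrite (ord1 i) -(@ler_pXn2r _ 2)// ?nnegrE ?enorm_ge0// enorm2.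
rewrite real_normK ?num_real// /dot (bigD1 j)//= -expr2 lerDl.
by apply: sumr_ge0 => k _; rewrite -expr2 sqr_ge0.
Qed.

Lemma enorm_le_mxnorm u : enorm u <= n.+1%:R * `|u|.
Proof.
rewrite -(@ler_pXn2r _ 2)// ?nnegrE ?mulr_ge0 ?enorm_ge0// enorm2.
apply: (@le_trans _ _ (\sum_(i < n) `|u| ^+ 2)).
  apply: ler_sum => i _; rewrite -expr2 -[u 0 i ^+ 2]real_normK ?num_real//.
  rewrite ler_pXn2r ?nnegrE// [`|u|]mx_normrE.
  exact: (le_bigmax _ (fun ij => `|u ij.1 ij.2|) (0, i)).
rewrite sumr_const card_ord -[_ *+ n]mulr_natl exprMn ler_wpM2r ?sqr_ge0//.
by rewrite expr2 -natrM ler_nat (leq_trans (leqnSn n))// leq_pmulr.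
Qed.

(** Neighbourhoods of row vectors in terms of the Euclidean norm. *)
Lemma nbhs_enormP (x : 'rV[R]_n) (P : set 'rV[R]_n) :
  nbhs x P <-> exists2 r : R, 0 < r & forall z, enorm (z - x) < r -> P z.
Proof.
split=> [/nbhs_ballP[r /= r0 h]|[r r0 h]].
  exists r => // z zr; apply: h; rewrite -ball_normE/=.
  by rewrite distrC; exact: le_lt_trans (mxnorm_le_enorm _) zr.
apply/nbhs_ballP; exists (r / n.+1%:R) => /=; first by rewrite divr_gt0.
move=> z; rewrite -ball_normE/= ltr_pdivlMr// mulrC distrC => zr; apply: h.
exact: le_lt_trans (enorm_le_mxnorm _) zr.
Qed.

End Euclid.

Section ConvexSets.
Context {R : realType} {n : nat}.
Implicit Types (D : set 'rV[R]_n) (x y : 'rV[R]_n).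

Lemma convex_set_comb D x y (s : R) : convex_set D -> 0 <= s <= 1 ->
  D x -> D y -> D (s *: x + (1 - s) *: y).
Proof.
move=> cD s01 Dx Dy.
have := cD x y (Itv01 (andP s01).1 (andP s01).2) (mem_set Dx) (mem_set Dy).
by rewrite inE.
Qed.

Lemma convex_set_line D x y (s : R) : convex_set D -> 0 <= s <= 1 ->
  D x -> D y -> D (x + s *: (y - x)).
Proof.
move=> cD s01 Dx Dy; have := convex_set_comb cD s01 Dy Dx.
by rewrite scalerBl scale1r scalerBr addrCA.
Qed.

End ConvexSets.

(** * Relative gradients along segments *)

Section Gradients.
Context {R : realType} {n : nat}.
Implicit Types (D : set 'rV[R]_n) (f : 'rV[R]_n -> R) (x y v : 'rV[R]_n).

Lemma is_gradP D f x v : is_grad D f x v <->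
  forall e : R, 0 < e -> exists2 r : R, 0 < r & forall z, D z ->
    enorm (z - x) < r -> `|f z - f x - dot v (z - x)| <= e * enorm (z - x).
Proof.
split=> h e /h.
  by move=> /nbhs_enormP[r r0 hr]; exists r => // z Dz zr; exact: hr.
by move=> [r r0 hr]; apply/nbhs_enormP; exists r => // z zr Dz; exact: hr.
Qed.

Lemma is_gradN D f x v : is_grad D f x v -> is_grad D (fun z => - f z) x (- v).
Proof.
move=> h e e0; move: (h e e0); apply: filterS => z.
rewrite dotNl.
have -> : - f z - - f x - - dot v (z - x) = - (f z - f x - dot v (z - x)) by ring.
by rewrite normrN.
Qed.

Lemma is_gradB D f1 f2 x v1 v2 : is_grad D f1 x v1 -> is_grad D f2 x v2 ->
  is_grad D (fun z => f1 z - f2 z) x (v1 - v2).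
Proof.
move=> h1 h2 e e0; have e2 : 0 < e / 2 by rewrite divr_gt0.
move: (h1 _ e2) (h2 _ e2); apply: filterS2 => z; rewrite dotDl dotNl.
set a := _ - _ - _; set b := _ - _ - _ => ha hb.
rewrite (_ : _ - _ = a - b); last by rewrite /a /b; ring.
by apply: (le_trans (ler_normB _ _)); lra.
Qed.

(** If the slope of f at x + s (y - x) in the direction y - x is at most
    a + s b, then f y <= f x + a + b / 2: the function
    f (x + s (y - x)) - s a - s ^ 2 b / 2 has a nonpositive derivative. *)
Lemma grad_segment_ub D f (g : 'rV[R]_n -> 'rV[R]_n) x y (a b : R) :
  convex_set D -> D x -> D y -> (forall z, D z -> is_grad D f z (g z)) ->
  (forall s : R, 0 <= s <= 1 -> dot (g (x + s *: (y - x))) (y - x) <= a + s * b) ->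
  f y <= f x + a + b / 2.
Proof.
move=> cD Dx Dy fg slope; set d := y - x.
pose p (s : R) := x + s *: d.
have Dp s : 0 <= s <= 1 -> D (p s) by move=> s01; exact: convex_set_line.
pose q s := f (p s) - s * a - s ^+ 2 * (b / 2).
pose dq s := dot (g (p s)) d - a - s * b.
have pB s t : p t - p s = (t - s) *: d.
  by rewrite /p opprD addrACA subrr add0r -scalerBl.
have near s : 0 <= s <= 1 -> forall e : R, 0 < e ->
    exists2 r : R, 0 < r & forall t, 0 <= t <= 1 -> `|t - s| < r ->
    `|q t - q s - (t - s) * dq s| <= e * `|t - s|.
  move=> s01 e e0.
  have d1 : 0 < enorm d + 1 by have := enorm_ge0 d; lra.
  have e1 : 0 < e / 2 / (enorm d + 1) by rewrite !divr_gt0.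
  have [r r0 hr] := (is_gradP D f (p s) _).1 (fg _ (Dp _ s01)) _ e1.
  pose b1 := `|b| + 1.
  have b10 : 0 < b1 by rewrite /b1; have := normr_ge0 b; lra.
  exists (Num.min (r / (enorm d + 1)) (e / b1)).
    by rewrite lt_min !divr_gt0.
  move=> t t01; rewrite lt_min => /andP[ts1 ts2].
  have := hr (p t) (Dp _ t01).
  rewrite pB enormZ dotZr => /(_ _)/wrap[|h].
    have : `|t - s| * (enorm d + 1) < r by rewrite -ltr_pdivlMr.
    by apply: le_lt_trans; rewrite ler_wpM2l//; lra.
  have -> : q t - q s - (t - s) * dq s =
     (f (p t) - f (p s) - (t - s) * dot (g (p s)) d)
      - (t - s) ^+ 2 * (b / 2) by rewrite /q /dq; field.
  have h1 : `|(t - s) ^+ 2 * (b / 2)| <= e / 2 * `|t - s|.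
    rewrite normrM normrX normrM (@gtr0_norm _ 2^-1)// expr2.
    have : `|t - s| * `|b| <= e.
      have : `|t - s| * b1 < e by rewrite -ltr_pdivlMr.
      by move=> /ltW; apply: le_trans; rewrite ler_wpM2l// /b1; lra.
    by have := normr_ge0 (t - s); nra.
  have h2 : e / 2 / (enorm d + 1) * (`|t - s| * enorm d) <= e / 2 * `|t - s|.
    rewrite (_ : _ * _ = e / 2 * `|t - s| * (enorm d / (enorm d + 1))).
      rewrite ler_piMr// ?mulr_ge0//; first lra.
      by rewrite ler_pdivrMr//; lra.
    by field; lra.
  by apply: (le_trans (ler_normB _ _)); lra.
have q01 : q 1 <= q 0.
  have [s||c] := @MVT R q dq 0 1 ltr01.
  - rewrite in_itv/= => /andP[s0 s1].
    suff H : (fun h : R => h^-1 *: (q (h *: 1 + s) - q s)) h @[h --> 0^'] --> dq s.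
      by apply: DeriveDef; [apply/cvg_ex; exists (dq s) | exact/cvg_lim].
    apply/cvgrPdist_le => e e0.
    have [|r r0 hr] := near s _ e e0; first lra.
    pose r' := Num.min r (Num.min s (1 - s)).
    have r'0 : 0 < r' by rewrite !lt_min r0 s0; lra.
    apply/nbhs_normP; exists r' => // h; rewrite /= sub0r normrN => hr' h0.
    move: hr'; rewrite !lt_min => /andP[hr1 /andP[hr2 hr3]].
    have := hr (h + s); rewrite addrK => /(_ _ hr1)/wrap[|h3].
      move: hr2 hr3; rewrite !ltr_norml; lra.
    rewrite [h *: 1]mulr1 [_ *: _](_ : _ = h^-1 * (q (h + s) - q s))//.
    have -> : dq s - h^-1 * (q (h + s) - q s) =
      - (h^-1 * (q (h + s) - q s - h * dq s)) by field.
    by rewrite normrN normrM normfV ler_pdivrMl ?normr_gt0// [leRHS]mulrC.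
  - apply/subspace_continuousP => s; rewrite /= in_itv/= => s01.
    apply/cvgrPdist_le => e e0.
    have [|r r0 hr] := near s _ 1 ltr01; first exact: s01.
    pose M := `|dq s| + 1.
    have M0 : 0 < M by rewrite /M; have := normr_ge0 (dq s); lra.
    apply/nbhs_normP; exists (Num.min r (e / M)).
      by rewrite /= lt_min r0 divr_gt0.
    move=> t /=; rewrite in_itv/= distrC lt_min => /andP[t1 t2] t01.
    have h3 := hr t t01 t1; rewrite mul1r in h3.
    rewrite distrC; have -> : q t - q s = (q t - q s - (t - s) * dq s) + (t - s) * dq s.
      by rewrite subrK.
    apply: (le_trans (ler_normD _ _)); rewrite normrM.
    move: t2; rewrite ltr_pdivlMr// /M mulrDr mulr1; lra.
  - rewrite in_itv/= => /andP[c0 c1]; rewrite subr0 mulr1 => qc.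
    by rewrite -subr_le0 qc /dq; have := slope c; rewrite -/d -/(p c); lra.
move: q01; rewrite /q /p scale1r scale0r addr0 /d subrKC; lra.
Qed.

(** The tangent inequality for convex functions. *)
Lemma convex_grad_lb D f x y v : convex_set D -> convex_function D f ->
  D x -> D y -> is_grad D f x v -> f x + dot v (y - x) <= f y.
Proof.
move=> cD cf Dx Dy /is_gradP fg; rewrite -subr_ge0.
apply/ler_addgt0Pl => e e0.
set d := y - x; have d1 : 0 < enorm d + 1 by have := enorm_ge0 d; lra.
have [|r r0 hr] := fg (e / (enorm d + 1)); first by rewrite divr_gt0.
pose s := Num.min 1 (r / 2 / (enorm d + 1)).
have s0 : 0 < s by rewrite lt_min ltr01 !divr_gt0.
have s1 : s <= 1 by rewrite /s ge_min lexx.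
have s01 : 0 <= s <= 1 by rewrite s1 ltW.
have sr : s * (enorm d + 1) <= r / 2.
  by rewrite -ler_pdivlMr// /s ge_min lexx orbT.
have := hr (x + s *: d) (convex_set_line cD s01 Dx Dy).
have -> : x + s *: d - x = s *: d by rewrite addrC addKr.
rewrite enormZ gtr0_norm// dotZr => /(_ _)/wrap[|h].
  by have := enorm_ge0 d; nra.
have h1 : f (s *: y + (1 - s) *: x) <= s * f y + (1 - s) * f x.
  exact: cf (Itv01 (ltW s0) s1) y x (mem_set Dy) (mem_set Dx).
have e1 : s *: y + (1 - s) *: x = x + s *: d.
  by rewrite /d scalerBl scale1r scalerBr addrCA.
move: h1; rewrite e1.
have h2 : e / (enorm d + 1) * (s * enorm d) <= e * s.
  rewrite (_ : _ * _ = e * s * (enorm d / (enorm d + 1))).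
    rewrite ler_piMr// ?mulr_ge0//; [exact: ltW|exact: ltW|].
    by rewrite ler_pdivrMr//; lra.
  by field; lra.
move: h; rewrite ler_norml => /andP[h _] h1.
have : 0 <= s * (e + (f y - (f x + dot v d))) by lra.
by rewrite pmulr_rge0.
Qed.

End Gradients.

(** * Strongly convex functions and their minimizers *)

Section QuadraticModels.
Context {R : realType} {n : nat}.
Implicit Types (D : set 'rV[R]_n) (f : 'rV[R]_n -> R)
  (g : 'rV[R]_n -> 'rV[R]_n) (x y z u v : 'rV[R]_n) (mu L : R).

(** f lies on D above the quadratic models of curvature mu with slopes g:
    f is mu-strongly convex, with subgradients g. No differentiability is
    involved, so the definition also applies to value functions. *)
Definition quad_lb D f g mu := forall u v, D u -> D v ->
  f v + dot (g v) (u - v) + mu / 2 * enorm (u - v) ^+ 2 <= f u.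

(** f lies on D below the quadratic models of curvature L with slopes g: the
    descent lemma holds with constant L. *)
Definition quad_ub D f g L := forall u v, D u -> D v ->
  f u <= f v + dot (g v) (u - v) + L / 2 * enorm (u - v) ^+ 2.

(** p is a minimizer of f over D. *)
Definition argmin_on D f p := D p /\ forall z, D z -> f p <= f z.

Lemma quad_lbW D f g mu mu' : mu' <= mu -> quad_lb D f g mu -> quad_lb D f g mu'.
Proof.
move=> le h u v Du Dv; apply: le_trans (h u v Du Dv).
by have := sqr_ge0 (enorm (u - v)); nra.
Qed.

Lemma quad_lb_growth D f g mu p : convex_set D -> quad_lb D f g mu ->
  argmin_on D f p -> forall u, D u -> f p + mu / 2 * enorm (u - p) ^+ 2 <= f u.
Proof.
move=> cD lb [Dp minp] u Du; apply/ler_addgt0Pl => e e0.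
set K := mu / 2 * _.
have den0 : 0 < e + `|K| + 1 by have := normr_ge0 K; lra.
pose s := e / (e + `|K| + 1).
have s0 : 0 < s by rewrite divr_gt0.
have s1 : s <= 1 by rewrite ler_pdivrMr// mul1r; have := normr_ge0 K; lra.
have sK : s * K <= e.
  apply: (@le_trans _ _ (s * (e + `|K| + 1))); last by rewrite divfK// gt_eqF.
  by rewrite ler_wpM2l ?(ltW s0)//; have := ler_norm K; lra.
have Dx : D (p + s *: (u - p)) by apply: convex_set_line => //; rewrite s1 ltW.
have := lb _ _ Du Dx; have := lb _ _ Dp Dx; have := minp _ Dx.
set x := p + _; have -> : u - x = (1 - s) *: (u - p).
  by rewrite /x opprD addrA scalerBl scale1r.
have -> : p - x = - s *: (u - p) by rewrite /x opprD addNKr scaleNr.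
rewrite !enormZ !exprMn !real_normK ?num_real// !dotZr.
set b := dot _ _; set N := enorm _ ^+ 2 => h1 h2 h3.
have KE : K = mu / 2 * N by [].
have : 0 <= s * (f u - f p - (1 - s) * K).
  have := ler_wpM2l (ltW s0) h3.
  have s1' : 0 <= 1 - s by lra.
  have := ler_wpM2l s1' h2; rewrite KE; nra.
rewrite pmulr_rge0//; nra.
Qed.

Lemma quad_lb_argmin D f g mu x0 : closed D -> convex_set D -> D x0 ->
  0 < mu -> quad_lb D f g mu -> exists p, argmin_on D f p.
Proof.
move=> clD cD Dx0 mu0 lb.
pose V := [set f x | x in D].
have V0 : V !=set0 by exists (f x0); exists x0.
have lV : has_lbound V.
  exists (f x0 - enorm (g x0) ^+ 2 / (2 * mu)) => _ [x Dx <-].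
  apply: le_trans (lb x x0 Dx Dx0).
  have := dot_ge (g x0) (x - x0); set a := enorm (g x0); set b := enorm _.
  move=> h; rewrite -subr_ge0.
  have : 0 <= (a - mu * b) ^+ 2 / (2 * mu) by rewrite divr_ge0 ?sqr_ge0//; lra.
  have -> : (a - mu * b) ^+ 2 / (2 * mu) =
    a ^+ 2 / (2 * mu) - a * b + mu / 2 * b ^+ 2 by field; lra.
  by lra.
have hV : has_inf V by split.
pose m := inf V.
have mle x : D x -> m <= f x by move=> Dx; apply: ge_inf => //; exists x.
pose F := filter_from [set e : R | 0 < e] (fun e => [set x | D x /\ f x < m + e]).
have FF : ProperFilter F.
  apply: filter_from_proper; last first.
    move=> e /= e0; have [_ [x Dx <-] xe] := inf_adherent e0 hV.
    by exists x.
  apply: filter_from_filter; first by exists 1 => /=.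
  move=> e1 e2 /= h1 h2; exists (Num.min e1 e2); first by rewrite /= lt_min h1.
  move=> x [Dx]; rewrite -ltrBlDl lt_min => /andP[/= k1 k2].
  by split; split => //; lra.
(* Two points where f < inf f + d are close: at their midpoint f is smaller
   than the mean of their values by mu / 8 times their squared distance. *)
have Fdist x y d : D x -> D y -> f x < m + d -> f y < m + d ->
    mu * enorm (x - y) ^+ 2 <= 8 * d.
  move=> Dx Dy fx fy.
  have h01 : 0 <= (2^-1 : R) <= 1 by lra.
  have Dz := convex_set_line cD h01 Dx Dy.
  have := lb _ _ Dx Dz; have := lb _ _ Dy Dz; have := mle _ Dz.
  set z := x + _.
  have -> : y - z = 2^-1 *: (y - x).
    have e2 : 2^-1 = 1 - 2^-1 :> R by field.
    by rewrite [in RHS]e2 scalerBl scale1r /z opprD addrA.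
  have -> : x - z = - 2^-1 *: (y - x) by rewrite /z opprD addNKr scaleNr.
  rewrite !dotZr !enormZ !exprMn !real_normK ?num_real// (enormB x).
  set b := dot _ _; set N := enorm _ ^+ 2 => h1 h2 h3; lra.
have cF : cauchy F.
  apply/cauchyP => e /= e0.
  pose d := mu * e ^+ 2 / 16.
  have d0 : 0 < d by rewrite divr_gt0// mulr_gt0// exprn_gt0.
  have [_ [x Dx <-] xd] := inf_adherent d0 hV.
  exists x; exists d => // y [Dy yd]; rewrite -ball_normE/=.
  apply: le_lt_trans (mxnorm_le_enorm _) _.
  have := Fdist _ _ _ Dx Dy xd yd.
  rewrite /d -(@ltr_pXn2r _ 2)// ?nnegrE ?enorm_ge0 ?(ltW e0)//.
  move=> h; rewrite -(ltr_pM2l mu0).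
  have : 0 < mu * e ^+ 2 by rewrite mulr_gt0// exprn_gt0.
  by lra.
have /cvg_ex[/= p Fp] := @cauchy_cvg _ F FF cF.
have Dp : D p.
  apply: clD => B /Fp [e e0 eB].
  by have [_ [x Dx <-] xe] := inf_adherent e0 hV; exists x; split => //; exact: eB.
exists p; split=> // z Dz; apply: le_trans (mle z Dz).
apply/ler_addgt0Pl => e e0.
have e2 : 0 < e / 2 by rewrite divr_gt0.
pose a := enorm (g p) + 1.
have a0 : 0 < a by rewrite /a; have := enorm_ge0 (g p); lra.
have : F [set x | enorm (x - p) < e / 2 / a].
  apply: Fp; apply/nbhs_enormP; exists (e / 2 / a) => //.
  by rewrite divr_gt0.
move=> [d /= d0 hd].
have de0 : 0 < Num.min d (e / 2) by rewrite lt_min d0.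
have [_ [x Dx <-] xd] := inf_adherent de0 hV.
move: xd; rewrite -ltrBlDl lt_min => /andP[xd xe].
have := hd x (conj Dx _); rewrite -ltrBlDl => /(_ xd) /=.
rewrite ltr_pdivlMr// /a => xp.
have := lb x p Dx Dp; have := dot_ge (g p) (x - p).
have := sqr_ge0 (enorm (x - p)); have := enorm_ge0 (x - p).
by rewrite -/m in xe; nra.
Qed.

End QuadraticModels.

(** * The fast gradient method with an inexact oracle *)

Section Prox.
Context {R : realType} {n : nat}.
Implicit Types (D : set 'rV[R]_n) (z u zeta : 'rV[R]_n).

Lemma prox_min D z zeta x0 : closed D -> convex_set D -> D x0 ->
  let p := prox z D zeta in
  D p /\ forall u, D u ->
    dot zeta p + 2^-1 * enorm (p - z) ^+ 2 + 2^-1 * enorm (u - p) ^+ 2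
      <= dot zeta u + 2^-1 * enorm (u - z) ^+ 2.
Proof.
move=> clD cD Dx0 p.
pose h z' := dot zeta z' + 2^-1 * enorm (z' - z) ^+ 2.
have lb : quad_lb D h (fun v => zeta + (v - z)) 1.
  move=> u v Du Dv; rewrite /h !enorm2 !dotE (dotC v u) (dotC z u) (dotC z v).
  by rewrite le_eqVlt; apply/orP; left; apply/eqP; field.
have [q hq] := quad_lb_argmin clD cD Dx0 ltr01 lb.
have pmin : argmin_on D h p by apply: (@xgetPex _ z (argmin_on D h)); exists q.
split; first exact: pmin.1.
by move=> u Du; have := quad_lb_growth cD lb pmin Du; rewrite mul1r.
Qed.

End Prox.

(** The weights A = t (t + 3) / 4 and a = (t + 2) / 2 of step t, the next
    A' = A + a, and the averaging parameter tau = a / A'. *)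
Lemma fgm_weights {R : realType} (t : nat) :
  let a : R := (t + 2)%:R / 2 in
  let tau : R := (2 * (t + 2))%:R / ((t + 1) * (t + 4))%:R in
  let A : R := t%:R * (t%:R + 3) / 4 in
  let A' : R := t.+1%:R * (t.+1%:R + 3) / 4 in
  [/\ 0 <= A, 0 < a, A' = A + a, tau * A' = a &
    0 <= tau <= 1 /\ A' * tau ^+ 2 <= 1].
Proof.
move=> a tau A A'.
have t0 : 0 <= t%:R :> R by [].
have A0 : 0 <= A by rewrite /A; nra.
have aE : a = (t%:R + 2) / 2 by rewrite /a natrD.
have A'E : A' = A + a by rewrite /A' /A aE -natr1; field.
have tauE : tau * A' = a.
  by rewrite /tau A'E aE /A !natrM !natrD; field; apply/andP; split; lra.
have a0 : 0 < a by rewrite aE; lra.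
have A'0 : 0 < A' by lra.
have tau_div : tau = a / A' by rewrite -tauE mulfK// gt_eqF.
split => //; split.
  by rewrite tau_div divr_ge0 ?(ltW a0) ?(ltW A'0)//= ler_pdivrMr//; lra.
have -> : A' * tau ^+ 2 = a ^+ 2 / A'.
  by rewrite tau_div; move: A'0; clear; move: A' a => x y x0; field; rewrite gt_eqF.
by rewrite ler_pdivrMr// A'E /A aE; move: t0; clear; move: t%:R => r; nra.
Qed.

(** The real inequality behind one step of the method. With the weights a,
    A' = A + a and tau = a / A', the gain N of the second prox step pays for
    the quadratic term of the descent lemma because A' tau ^ 2 <= 1. *)
Lemma fgm_step_core {R : realType}
    (gam A A' a tau fz fz' fv b Gu0 Gu gu gw gv p q n1 n2 n3 N : R) :
  0 < gam -> 0 <= A -> 0 < A' -> A' = A + a -> tau * A' = a ->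
  A' * tau ^+ 2 <= 1 -> 0 <= N ->
  A * fz <= b + Gu0 + (2 * gam)^-1 * n1 ->
  gam * Gu0 + 2^-1 * n1 + 2^-1 * n2 <= gam * Gu + 2^-1 * n3 ->
  gam * (a * gw) + 2^-1 * N <= gam * (a * gu) + 2^-1 * n2 ->
  fv - tau * q <= fz ->
  fz' <= fv + tau * p + gam^-1 / 2 * (tau ^+ 2 * N) ->
  A' * fz' <= b + a * (fv - gv + (gv - gw + p + (1 - tau) * q))
    + (Gu + a * gu) + (2 * gam)^-1 * n3.
Proof.
move=> g0 A0 A'0 A'E tauE A'tau N0 hb hu hw h3 h4.
have i0 : 0 <= gam^-1 by rewrite invr_ge0 ltW.
have iE : (2 * gam)^-1 = gam^-1 / 2 by field; lra.
rewrite iE in hb *.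
have ig : gam^-1 * gam = 1 by rewrite mulVf//; lra.
have hu' := ler_wpM2l i0 hu.
have hw' := ler_wpM2l i0 hw.
rewrite !mulrDr !mulrA ig !mul1r in hu' hw'.
have h7 := ler_wpM2l (ltW A'0) h4.
have h8 := ler_wpM2l A0 h3.
have AE : A * (tau * q) = a * ((1 - tau) * q).
  have -> : A = A' - a by lra.
  by rewrite -tauE; ring.
have h9 : A' * (tau * p) = a * p by rewrite mulrA [A' * _]mulrC tauE.
have h6 : A' * (gam^-1 / 2 * (tau ^+ 2 * N)) <= gam^-1 / 2 * N.
  have -> : A' * (gam^-1 / 2 * (tau ^+ 2 * N)) = (A' * tau ^+ 2) * (gam^-1 / 2 * N).
    by ring.
  by rewrite ler_piMl// mulr_ge0//; lra.
rewrite mulrBr AE in h8.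
rewrite !mulrDr h9 in h7.
have h10 : A' * fv = A * fv + a * fv by rewrite A'E mulrDl.
lra.
Qed.

Section FGM.
Context {R : realType} {n : nat}.
Variables (D : set 'rV[R]_n) (f : 'rV[R]_n -> R) (g : 'rV[R]_n -> 'rV[R]_n).
Variables (gam eta : R) (og : oracle R n).
Hypotheses (clD : closed D) (cD : convex_set D) (gam0 : 0 < gam).
Hypotheses (flb : quad_lb D f g 0) (fub : quad_ub D f g gam^-1).
Hypothesis og_err : forall v u w, D v -> D u -> D w ->
  dot ((og v).1 - g v) (u - w) <= eta.

(** The estimate-sequence invariant: with A = t (t + 3) / 4, the quantity
    A f(z_t) is a lower bound of the model
    b + <G_t, u> + |u - z0|^2 / (2 gam), whose linear part is itself bounded
    by A (f + eta). The oracle error enters only through its pairing with a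
    difference of two points of D, so that it does not accumulate. *)
Lemma fgm_iter_inv z0 (t : nat) : D z0 ->
  let st := fgm_iter z0 D gam og t in
  let A : R := t%:R * (t%:R + 3) / 4 in
  D st.1.1 /\ exists b : R, forall u, D u ->
    A * f st.1.1 <= b + dot st.1.2 u + (2 * gam)^-1 * enorm (u - z0) ^+ 2 /\
    b + dot st.1.2 u <= A * (f u + eta).
Proof.
have gp := gam0; move=> Dz0; elim: t => [|t] /=.
  split => //; exists 0 => u Du.
  rewrite !mul0r !dot0l !add0r; split => //.
  by apply: mulr_ge0; rewrite ?sqr_ge0// invr_ge0; lra.
case: (fgm_iter z0 D gam og t) => [[z G] c] /= [Dz [b hb]].
have := @fgm_weights R t.
set a : R := (t + 2)%:R / 2; set tau : R := _ / _.
set A : R := t%:R * (t%:R + 3) / 4 in hb *.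
set A' : R := t.+1%:R * (t.+1%:R + 3) / 4.
clearbody a tau A A' => -[A0 a0 A'E tauE [tau01 A'tau]].
have A'0 : 0 < A' by lra.
set u0 := prox z0 D (gam *: G).
set v := tau *: u0 + (1 - tau) *: z.
rewrite (surjective_pairing (og v)) /=; set gv := (og v).1.
set w := prox u0 D _.
have [Du0 hu0] := prox_min z0 (gam *: G) clD cD Dz0.
rewrite -/u0 in Du0 hu0.
have [Dw hw] := prox_min u0 (gam *: (a *: gv)) clD cD Dz0.
rewrite -/w in Dw hw.
have Dv : D v by exact: convex_set_comb.
have Dz' : D (tau *: w + (1 - tau) *: z) by exact: convex_set_comb.
split => //.
have err x y : D x -> D y -> dot (gv - g v) (x - y) <= eta.
  by move=> Dx Dy; exact: og_err.
exists (b + a * (f v - dot gv v + dot (gv - g v) (v - w))) => u Du.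
have [hb1 hb2] := hb u Du; split; last first.
  rewrite [dot (G + _) u]dotDl dotZl A'E [leRHS]mulrDl.
  have h1 : a * (f v - dot gv v + dot (gv - g v) (v - w) + dot gv u)
      <= a * (f u + eta).
    rewrite ler_wpM2l ?(ltW a0)//.
    have := flb Du Dv; have := err _ _ Du Dw.
    rewrite mul0r mul0r addr0.
    have -> : dot (gv - g v) (v - w) = dot (gv - g v) (u - w) - dot gv u
        + dot gv v + dot (g v) (u - v).
      rewrite -[u - w](subrKA v) [dot _ (u - v + _)]dotDr
        [dot _ (u - v)]dotBB.
      by rewrite -[v - u]opprB dotNr; ring.
    lra.
  lra.
have [{hb2}hb1' _] := hb u0 Du0.
set z' := tau *: w + _ in Dz' *.
have z'v : z' - v = tau *: (w - u0).
  by rewrite /z' /v; apply/rowP => i; rewrite !mxE; ring.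
have zv : z - v = - tau *: (u0 - z).
  by rewrite /v; apply/rowP => i; rewrite !mxE; ring.
have wv : w - v = (w - u0) + (1 - tau) *: (u0 - z).
  by rewrite /v; apply/rowP => i; rewrite !mxE; ring.
have h3 := flb Dz Dv; have h4 := fub Dz' Dv.
rewrite mul0r mul0r addr0 zv dotZr mulNr in h3.
rewrite z'v dotZr enormZ exprMn real_normK ?num_real// in h4.
have -> : dot (gv - g v) (v - w) = dot gv v - dot gv w + dot (g v) (w - u0)
    + (1 - tau) * dot (g v) (u0 - z).
  by rewrite dotBB wv dotDr dotZr addrA.
rewrite [dot (G + _) u]dotDl [dot (a *: gv) u]dotZl.
have hu := hu0 u Du; rewrite !dotZl in hu.
have {hw} := hw u Du; rewrite !dotZl => /(le_trans _) hw.
apply: fgm_step_core hb1' hu _ h3 h4 => //; first exact: sqr_ge0.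
by apply: hw; rewrite lerDl mulr_ge0 ?sqr_ge0.
Qed.

(** The rate of the method, for every comparison point u. *)
Lemma fgm_rate z0 u (T : nat) : D z0 -> D u -> (0 < T)%N ->
  let z := (fgm z0 D gam T og).1 in
  D z /\ f z - f u <=
    2 / (gam * (T%:R * (T%:R + 3))) * enorm (z0 - u) ^+ 2 + eta.
Proof.
have gp := gam0; move=> Dz0 Du T0; have := fgm_iter_inv T Dz0.
rewrite /fgm; case: fgm_iter => [[z G] c] /= [Dz [b /(_ u Du)[h1 h2]]].
split => //; move: h1 h2; rewrite (enormB u).
have {T0} T0 : 1 <= T%:R :> R by rewrite ler1n.
set A : R := _ / 4; set N := enorm _ ^+ 2 => h1 h2.
have A0 : 0 < A by rewrite /A; nra.
rewrite -(ler_pM2l A0).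
have -> : A * (2 / (gam * (T%:R * (T%:R + 3))) * N + eta) =
  (2 * gam)^-1 * N + A * eta by rewrite /A; field; lra.
lra.
Qed.

End FGM.

Section Restart.
Context {R : realType} {n : nat}.
Variables (D : set 'rV[R]_n) (f : 'rV[R]_n -> R) (g : 'rV[R]_n -> 'rV[R]_n).
Variables (gam eta : R) (og : oracle R n).
Hypotheses (clD : closed D) (cD : convex_set D) (gam0 : 0 < gam).
Hypotheses (flb : quad_lb D f g 0) (fub : quad_ub D f g gam^-1).
Hypothesis og_err : forall v u w, D v -> D u -> D w ->
  dot ((og v).1 - g v) (u - w) <= eta.

(** Restarts converge linearly: when a stage of T steps divides the bound on
    the gap by 8, both the gap and mu / 2 times the squared distance to the
    minimizer are at most 8 ^ (- S) (mu / 2) |z0 - p| ^ 2 + 2 eta. *)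
Lemma restart_rate mu p z0 (T S : nat) : 0 <= eta -> 0 < mu ->
  quad_lb D f g mu -> argmin_on D f p -> D z0 -> (0 < T)%N ->
  32 <= mu * gam * (T%:R * (T%:R + 3)) ->
  let z := (restart_fgm z0 D gam T S og).1 in
  let B := (8^-1) ^+ S * (mu / 2 * enorm (z0 - p) ^+ 2) + 2 * eta in
  [/\ D z, mu / 2 * enorm (z - p) ^+ 2 <= B & (0 < S)%N -> f z - f p <= B].
Proof.
have gp := gam0; move=> eta0 mu0 lb pmin Dz0 T0 hT; elim: S => [|S] /=.
  by split; rewrite // expr0 mul1r lerDl; lra.
case: (restart_fgm z0 D gam T S og) => [z c] /= [Dz h1 _].
have := fgm_rate clD cD gam0 flb fub og_err Dz pmin.1 T0.
case: (fgm z D gam T og) => [z' c'] /= [Dz' h2].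
have {T0} T0 : 1 <= T%:R :> R by rewrite ler1n.
set K := mu / 2 * enorm (z0 - p) ^+ 2 in h1 *.
set N := enorm (z - p) ^+ 2 in h1 h2.
have N0 : 0 <= N by exact: sqr_ge0.
set TT := T%:R * _ in hT h2.
have TT0 : 0 < TT by rewrite /TT; nra.
have h3 : 2 / (gam * TT) * N <= 8^-1 * (mu / 2 * N).
  rewrite [leRHS]mulrA ler_wpM2r// ler_pdivrMr; last exact: mulr_gt0.
  lra.
rewrite [_ ^+ S.+1]exprS -[_ * _ * K]mulrA; set X := _ ^+ S * K in h1 *.
have gap : f z' - f p <= 8^-1 * X + 2 * eta by lra.
split => //.
by have := quad_lb_growth cD lb pmin Dz'; lra.
Qed.

End Restart.

Section Cost.
Context {R : realType} {n : nat}.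
Variables (D : set 'rV[R]_n) (gam : R) (og : oracle R n) (k : nat).
Hypothesis og_cost : forall v, (og v).2 = k.

Lemma fgm_cost z0 T : (fgm z0 D gam T og).2 = (T * k)%N.
Proof.
suff : (fgm_iter z0 D gam og T).2 = (T * k)%N.
  by rewrite /fgm; case: fgm_iter => [[z G] c].
elim: T => [|T] //=; case: fgm_iter => [[z G] c] /= ->.
set v := (X in og X); move: (og_cost v); case: (og v) => gv cv /= ->.
by rewrite mulSn addnC.
Qed.

Lemma restart_cost z0 T S : (restart_fgm z0 D gam T S og).2 = (S * (T * k))%N.
Proof.
elim: S => [|S] //=; case: restart_fgm => z c /= ->.
by move: (fgm_cost z T); case: fgm => z' c' /= ->; rewrite mulSn addnC.
Qed.

End Cost.

(** * Smooth functions and quadratic models *)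

Section Models.
Context {R : realType} {n : nat}.
Implicit Types (D : set 'rV[R]_n) (f : 'rV[R]_n -> R)
  (g : 'rV[R]_n -> 'rV[R]_n) (c x : 'rV[R]_n) (mu L a : R).

(** The descent lemma. *)
Lemma lipschitz_quad_ub D f g L : convex_set D ->
  (forall z, D z -> is_grad D f z (g z)) ->
  (forall x x', D x -> D x' -> enorm (g x' - g x) <= L * enorm (x' - x)) ->
  quad_ub D f g L.
Proof.
move=> cD fg lip u v Du Dv.
have := @grad_segment_ub _ _ D f g v u (dot (g v) (u - v))
  (L * enorm (u - v) ^+ 2) cD Dv Du fg.
rewrite (mulrAC L _ 2^-1); apply => s s01.
have Ds := convex_set_line cD s01 Dv Du.
rewrite -lerBlDl -dotNl -dotDl; apply: le_trans (dot_le _ _) _.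
have := lip _ _ Dv Ds; rewrite [v + _ - v]addrC addKr enormZ.
case/andP: s01 => s0 _; rewrite ger0_norm// => h.
by have := ler_wpM2r (enorm_ge0 (u - v)) h; lra.
Qed.

Lemma lipschitz_quad_lb D f g L : convex_set D ->
  (forall z, D z -> is_grad D f z (g z)) ->
  (forall x x', D x -> D x' -> enorm (g x' - g x) <= L * enorm (x' - x)) ->
  quad_lb D f g (- L).
Proof.
move=> cD fg lip u v Du Dv.
have ub : quad_ub D (fun z => - f z) (fun z => - g z) L.
  apply: lipschitz_quad_ub => // [z Dz|x x' Dx Dx']; first exact/is_gradN/fg.
  by rewrite -opprD enormN; exact: lip.
by have := ub u v Du Dv; rewrite dotNl; lra.
Qed.

Let sq_model a c u v : a * enorm (u - c) ^+ 2 = a * enorm (v - c) ^+ 2 +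
  dot ((2 * a) *: (v - c)) (u - v) + a * enorm (u - v) ^+ 2.
Proof. by rewrite !enorm2 !dotE !(dotC c) (dotC v u); ring. Qed.

Lemma quad_lb_addsq D f g mu a c : quad_lb D f g mu ->
  quad_lb D (fun x => f x + a * enorm (x - c) ^+ 2)
    (fun x => g x + (2 * a) *: (x - c)) (mu + 2 * a).
Proof.
move=> lb u v Du Dv; rewrite (sq_model a c u v) dotDl.
by have := lb u v Du Dv; lra.
Qed.

Lemma quad_ub_addsq D f g L a c : quad_ub D f g L ->
  quad_ub D (fun x => f x + a * enorm (x - c) ^+ 2)
    (fun x => g x + (2 * a) *: (x - c)) (L + 2 * a).
Proof.
move=> ub u v Du Dv; rewrite (sq_model a c u v) dotDl.
by have := ub u v Du Dv; lra.
Qed.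

(** An approximate minimizer is approximately stationary: move from x towards
    x' by the fraction th of the way. *)
Lemma approx_min_slope D f g L x x' (e th : R) : convex_set D ->
  quad_ub D f g L -> D x -> D x' -> (forall z, D z -> f x <= f z + e) ->
  0 < th <= 1 ->
  - dot (g x) (x' - x) <= e / th + L / 2 * th * enorm (x' - x) ^+ 2.
Proof.
move=> cD ub Dx Dx' hx /andP[th0 th1].
have Dz : D (x + th *: (x' - x)) by apply: convex_set_line; rewrite ?th1 ?ltW.
have := ub _ _ Dz Dx; have := hx _ Dz; set z := x + _.
have -> : z - x = th *: (x' - x) by rewrite /z addrC addKr.
rewrite dotZr enormZ exprMn real_normK ?num_real//.
set b := dot _ _; set N := enorm _ ^+ 2 => h1 h2.
rewrite -(ler_pM2l th0).
have -> : th * (e / th + L / 2 * th * N) = e + L / 2 * (th ^+ 2 * N) by field; lra.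
lra.
Qed.

End Models.

(** * The regularized problems of one outer iteration *)

Section Problem.
Context {R : realType} {n m : nat}.
Variable P : minimax R n m.
Hypothesis hst : standing P.
Let X := dX P.
Let Y := dY P.
Let F := obj P.
Implicit Types (x c p : 'rV[R]_n) (y : 'rV[R]_m).

Lemma obj_quad_ub_x y : Y y -> quad_ub X (F ^~ y) (gradx P ^~ y) (Lxx P).
Proof.
move=> Yy; apply: lipschitz_quad_ub; first exact: X_convex hst.
  by move=> x Xx; exact: gradx_grad.
by move=> x x' Xx Xx'; exact: gradx_lipx.
Qed.

Lemma obj_quad_lb_x y : Y y -> quad_lb X (F ^~ y) (gradx P ^~ y) (- Lxx P).
Proof.
move=> Yy; apply: lipschitz_quad_lb; first exact: X_convex hst.
  by move=> x Xx; exact: gradx_grad.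
by move=> x x' Xx Xx'; exact: gradx_lipx.
Qed.

Lemma obj_quad_lb_y x : X x -> quad_lb Y (F x) (grady P x) (- Lyy P).
Proof.
move=> Xx; apply: lipschitz_quad_lb; first exact: Y_convex hst.
  by move=> y Yy; exact: grady_grad.
by move=> y y' Yy Yy'; exact: grady_lipy.
Qed.

Lemma obj_concave_ub x y y' : X x -> Y y -> Y y' ->
  F x y' <= F x y + dot (grady P x y) (y' - y).
Proof.
move=> Xx Yy Yy'; rewrite -lerN2 opprD -dotNl.
apply: (@convex_grad_lb _ _ Y (fun y => - F x y)) => //.
- exact: Y_convex.
- exact: obj_concave.
- exact/is_gradN/grady_grad.
Qed.

(** The increments of F in x vary with y at the rate Lxy. *)
Lemma obj_cross x x' y y' : X x -> X x' -> Y y -> Y y' ->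
  F x y - F x' y <= F x y' - F x' y' + Lxy P * enorm (x - x') * enorm (y - y').
Proof.
move=> Xx Xx' Yy Yy'.
have := @grad_segment_ub _ _ Y (fun y => F x y - F x' y)
  (fun y => grady P x y - grady P x' y) y' y
  (Lxy P * enorm (x - x') * enorm (y - y')) 0 (Y_convex hst) Yy' Yy.
rewrite mul0r addr0; apply.
  by move=> z Yz; apply: is_gradB; exact: grady_grad.
move=> s s01; have Ys := convex_set_line (Y_convex hst) s01 Yy' Yy.
rewrite mulr0 addr0; apply: le_trans (dot_le _ _) _.
by rewrite ler_wpM2r ?enorm_ge0//; exact: grady_lipx.
Qed.

Lemma diamY y y' : Y y -> Y y' -> enorm (y - y') <= 2 * Ry P.
Proof.
move=> Yy Yy'; have [c hc] := Y_ball hst.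
apply: le_trans (enorm_sub_le y y' c) _.
by have := hc _ Yy; have := hc _ Yy'; lra.
Qed.

Lemma diamY_dot y y' (v : 'rV[R]_m) : Y y -> Y y' ->
  dot v (y - y') <= enorm v * (2 * Ry P).
Proof.
move=> Yy Yy'; apply: le_trans (dot_le _ _) _.
by rewrite ler_wpM2l ?enorm_ge0 ?diamY.
Qed.

Lemma primal_attained x : X x -> exists2 y, Y y & primal P x = F x y /\
  forall y', Y y' -> F x y' <= F x y.
Proof.
move=> Xx.
have [y0 /interior_subset Y0] := Y_interior hst.
have [||y Yy ymax] := @EVT_max_rV R m (F x) Y _ (Y_compact hst).
- by exists y0.
- apply/subspace_continuousP => y Yy; apply/cvgrPdist_le => e e0.
  have [r r0 hr] := (is_gradP Y (F x) y _).1 (grady_grad hst Xx Yy) 1 ltr01.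
  pose M := enorm (grady P x y) + 1.
  have M0 : 0 < M by rewrite /M; have := enorm_ge0 (grady P x y); lra.
  apply/nbhs_enormP; exists (Num.min r (e / M)); first by rewrite lt_min r0 divr_gt0.
  move=> z; rewrite lt_min ltr_pdivlMr// => /andP[z1 z2] Yz.
  rewrite distrC; have h := hr z Yz z1.
  have -> : F x z - F x y = (F x z - F x y - dot (grady P x y) (z - y))
    + dot (grady P x y) (z - y) by rewrite subrK.
  apply: (le_trans (ler_normD _ _)).
  by have := cauchy_schwarz (grady P x y) (z - y); rewrite /M in z2; lra.
rewrite inE in Yy.
have ymax' y' : Y y' -> F x y' <= F x y by move=> Yy'; apply: ymax; rewrite inE.
exists y => //; split => //; apply/eqP; rewrite eq_le; apply/andP; split.
  by apply: ge_sup; [exists (F x y); exists y | move=> _ [y' Yy' <-]; exact: ymax'].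
apply: ub_le_sup; last by exists y.
by exists (F x y) => _ [y' Yy' <-]; exact: ymax'.
Qed.

Lemma obj_le_primal x y : X x -> Y y -> F x y <= primal P x.
Proof. by move=> Xx Yy; have [y' _ [->]] := primal_attained Xx; exact. Qed.

Let phimin := inf [set primal P x | x in X].

Lemma phimin_le x : X x -> phimin <= primal P x.
Proof. by move=> Xx; apply: ge_inf; [exact: primal_bounded hst|exists x]. Qed.

(** The regularized objective F(., y) + Lxx |. - c|^2, and its gradient. *)
Definition hreg c y x := F x y + Lxx P * enorm (x - c) ^+ 2.
Definition greg c y x := gradx P x y + (2 * Lxx P) *: (x - c).

Lemma hreg_lb c y : Y y -> quad_lb X (hreg c y) (greg c y) (Lxx P).
Proof.
move=> Yy; have := quad_lb_addsq (Lxx P) c (obj_quad_lb_x Yy).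
by have -> : - Lxx P + 2 * Lxx P = Lxx P by ring.
Qed.

Lemma hreg_ub c y : Y y -> quad_ub X (hreg c y) (greg c y) (3 * Lxx P).
Proof.
move=> Yy; have := quad_ub_addsq (Lxx P) c (obj_quad_ub_x Yy).
by have -> : Lxx P + 2 * Lxx P = 3 * Lxx P by ring.
Qed.

(** The minimizer of the regularized objective over X; c is a default value. *)
Definition regmin c y := xget c (argmin_on X (hreg c y)).

Lemma regminP c y : X c -> Y y -> argmin_on X (hreg c y) (regmin c y).
Proof.
move=> Xc Yy; apply: xgetPex.
exact: (quad_lb_argmin (X_closed hst) (X_convex hst) Xc (Lxx_gt0 hst) (hreg_lb c Yy)).
Qed.

Lemma Lyyp_gt : Lyy P < Lyyp P.
Proof.
by rewrite /Lyyp ltrDl divr_gt0 ?exprn_gt0 ?(Lxy_gt0 hst) ?(Lxx_gt0 hst).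
Qed.

(** The distance from the prox center to the regularized minimizer does not
    depend on the values of F at y: the decrease of F(., y) differs from that
    of the primal function by at most 2 Lxy Ry |c - p|, which the proximal
    term dominates. *)
Lemma regmin_dist c y : X c -> Y y ->
  Lxx P / 2 * enorm (c - regmin c y) ^+ 2 <=
    primal P c - phimin + (Lyyp P - Lyy P) * Ry P ^+ 2.
Proof.
move=> Xc Yy; have pmin := regminP Xc Yy.
have := quad_lb_growth (X_convex hst) (hreg_lb c Yy) pmin Xc.
set p := regmin c y in pmin *.
have [Xp _] := pmin; rewrite /hreg subrr enorm0 expr0n/= mulr0 addr0.
have [y' Yy' [pE _]] := primal_attained Xp.
have := obj_cross Xc Xp Yy Yy'; have := obj_le_primal Xc Yy'.
have := phimin_le Xp; rewrite pE (enormB p c).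
have := diamY Yy Yy'.
have LE : Lyyp P - Lyy P = Lxy P ^+ 2 / Lxx P by rewrite /Lyyp addrC addKr.
rewrite LE; set d := enorm (c - p); set b := enorm (y - y').
have d0 : 0 <= d := enorm_ge0 _.
move: (Lxx_gt0 hst) (Lxy_gt0 hst) => Lx Lc hb h1 h2 h3 h4.
have h5 : Lxy P * d * b <= Lxy P * d * (2 * Ry P).
  by rewrite ler_wpM2l// mulr_ge0// ltW.
have h6 : Lxy P * d * (2 * Ry P) <= Lxx P * d ^+ 2 + Lxy P ^+ 2 / Lxx P * Ry P ^+ 2.
  have : 0 <= (Lxx P * d - Lxy P * Ry P) ^+ 2 / Lxx P.
    by rewrite divr_ge0 ?sqr_ge0 ?ltW.
  have -> : (Lxx P * d - Lxy P * Ry P) ^+ 2 / Lxx P = Lxx P * d ^+ 2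
     + Lxy P ^+ 2 / Lxx P * Ry P ^+ 2 - Lxy P * d * (2 * Ry P) by field; lra.
  by rewrite subr_ge0.
lra.
Qed.

(** The dual function of the regularized problem and its slope, the gradient
    of F in y at the regularized minimizer, both with the opposite sign. *)
Definition ndual c y := - hreg c y (regmin c y).
Definition gndual c y := - grady P (regmin c y) y.

Lemma ndual_lb c : X c -> quad_lb Y (ndual c) (gndual c) 0.
Proof.
move=> Xc u v Yu Yv; rewrite /ndual /gndual mul0r mul0r addr0.
have [Xp _] := regminP Xc Yv; have [_ /(_ _ Xp) h1] := regminP Xc Yu.
have := obj_concave_ub Xp Yv Yu; move: h1; rewrite /hreg dotNl; lra.
Qed.

(** The minimizer moves with y at the rate Lxy / Lxx, which raises the
    smoothness constant of the dual function from Lyy to Lyyp. *)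
Lemma ndual_ub c : X c -> quad_ub Y (ndual c) (gndual c) (Lyyp P).
Proof.
move=> Xc u v Yu Yv; rewrite /ndual /gndual.
have vmin := regminP Xc Yv; have [Xp _] := vmin.
have [Xq _] := regminP Xc Yu.
set p := regmin c v in vmin Xp *; set q := regmin c u in Xq *.
have := quad_lb_growth (X_convex hst) (hreg_lb c Yv) vmin Xq.
have := obj_quad_lb_y Xq Yu Yv.
have := grady_lipx hst Xp Xq Yv.
have := dot_ge (grady P q v - grady P p v) (u - v).
rewrite /hreg dotNl dotDl dotNl /Lyyp.
set a := enorm (q - p); set b := enorm (u - v).
set dp := dot (grady P p v) _; set dq := dot (grady P q v) _.
have a0 : 0 <= a := enorm_ge0 _; have b0 : 0 <= b := enorm_ge0 _.
move: (Lxx_gt0 hst) => Lx h1 h2 h3 h4.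
have h5 : enorm (grady P q v - grady P p v) * b <= Lxy P * a * b.
  by rewrite ler_wpM2r.
have h6 : Lxy P * a * b <= Lxx P / 2 * a ^+ 2 + Lxy P ^+ 2 / Lxx P / 2 * b ^+ 2.
  have : 0 <= (Lxx P * a - Lxy P * b) ^+ 2 / (2 * Lxx P).
    by rewrite divr_ge0 ?sqr_ge0//; lra.
  have -> : (Lxx P * a - Lxy P * b) ^+ 2 / (2 * Lxx P) = Lxx P / 2 * a ^+ 2
     + Lxy P ^+ 2 / Lxx P / 2 * b ^+ 2 - Lxy P * a * b by field; lra.
  by rewrite subr_ge0.
lra.
Qed.

End Problem.

(** * One outer iteration *)

Section Step.
Context {R : realType} {n m : nat}.
Variable P : minimax R n m.
Hypothesis hst : standing P.
Implicit Types (x c : 'rV[R]_n) (y ybar : 'rV[R]_m).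

(** A bound, uniform in y, on Lxx / 2 |c - p|^2 for the minimizer p of the
    regularized problem centered at c. *)
Definition gap_bound c : R :=
  primal P c - inf [set primal P x | x in dX P] + (Lyyp P - Lyy P) * Ry P ^+ 2.

Let solve c ybar lam S y :=
  solve_reg_dual P y c ybar (1 / (2 * Lxx P)) lam 11 S.

Lemma solve_reg_dual_cost c ybar lam S y : (solve c ybar lam S y).2 = (S * 11 + 1)%N.
Proof.
rewrite /solve /solve_reg_dual; set og := (fun x => _).
have := @restart_cost _ _ (dX P) (2 / 3 * (1 / (2 * Lxx P))) og 1 (fun _ => erefl) c 11 S.
by case: restart_fgm => x k /= ->; rewrite muln1.
Qed.

Lemma solve_reg_dual_spec c ybar lam S y : dX P c -> dY P y ->
  let r := solve c ybar lam S y in let p := regmin P c y in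
  let B := 8^-1 ^+ S * gap_bound c in
  [/\ dX P r.1.1, r.1.2 = grady P r.1.1 y - lam *: (y - ybar),
      Lxx P / 2 * enorm (r.1.1 - p) ^+ 2 <= B &
      (0 < S)%N -> hreg P c y r.1.1 <= hreg P c y p + B].
Proof.
move=> Xc Yy r p B; have Lx := Lxx_gt0 hst.
rewrite /r /solve /solve_reg_dual; set og := (fun x => _).
set gam := 2 / 3 * _.
have gamE : gam^-1 = 3 * Lxx P by rewrite /gam; field; lra.
have gam0 : 0 < gam by rewrite -invr_gt0 gamE; lra.
have lb := hreg_lb hst c Yy.
have lb0 := quad_lbW (ltW Lx) lb.
have ub := hreg_ub hst c Yy; rewrite -gamE in ub.
have og_err v u w : dX P v -> dX P u -> dX P w ->
    dot ((og v).1 - greg P c y v) (u - w) <= 0.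
  move=> _ _ _; rewrite /og /greg /=.
  have -> : (1 / (2 * Lxx P))^-1 = 2 * Lxx P by field; lra.
  by rewrite subrr dot0l.
have := @restart_rate _ _ _ _ _ gam 0 og (X_closed hst) (X_convex hst) gam0 lb0 ub
  og_err (Lxx P) p c 11 S (lexx 0) Lx lb (regminP hst Xc Yy) Xc isT.
have -> : 32 <= Lxx P * gam * (11%:R * (11%:R + 3)).
  have -> : Lxx P * gam * (11%:R * (11%:R + 3)) = 154 / 3.
    by rewrite -[gam]invrK gamE; field; lra.
  lra.
case: restart_fgm => x k /= /(_ isT)[Xx h1 h2].
have := regmin_dist hst Xc Yy; rewrite -/p -/(gap_bound c) => hd.
have hB : 8^-1 ^+ S * (Lxx P / 2 * enorm (c - p) ^+ 2) <= B.
  by rewrite ler_wpM2l// exprn_ge0// invr_ge0.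
split => // [|/h2]; lra.
Qed.

Lemma gap_bound_ge0 c : dX P c -> 0 <= gap_bound c.
Proof.
move=> Xc; rewrite addr_ge0//; first by rewrite subr_ge0 phimin_le.
by rewrite mulr_ge0 ?sqr_ge0// subr_ge0 ltW// Lyyp_gt.
Qed.

Lemma outer_step c ybar lam (T S So : nat) rho :
  let L := Lyyp P + lam in
  let B := 8^-1 ^+ So * gap_bound c in
  dX P c -> dY P ybar -> 0 < lam -> (0 < T)%N -> (0 < S)%N -> (0 < So)%N ->
  40 * L <= lam * T%:R ^+ 2 -> 0 <= rho ->
  2 * ((Lyyp P - Lyy P) * Ry P ^+ 2) * B <= rho ^+ 2 ->
  let y := (restart_fgm ybar (dY P) (1 / L) T S
    (fun y => let: (_, gpsi, k) := solve c ybar lam So y in (- gpsi, k))).1 in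
  let x := (solve c ybar lam So y).1.1 in
  [/\ dX P x, dY P y, forall z, dX P z -> hreg P c y x <= hreg P c y z + B &
    forall th, 0 < th <= 1 -> primal P x <= obj P x y
      + ((8^-1 ^+ S * (2 * lam * Ry P ^+ 2) + 4 * rho) / th
         + 2 * L * th * Ry P ^+ 2 + 4 * lam * Ry P ^+ 2 + 2 * rho)].
Proof.
move=> L B Xc Yb lam0 T0 S0 So0 hT rho0 hrho; set og := (fun y => _).
have [Lx Lc Ly hR] := And4 (Lxx_gt0 hst) (Lxy_gt0 hst) (Lyy_gt0 hst) (Ry_gt0 hst).
have LL := Lyyp_gt hst.
have L0 : 0 < L by rewrite /L; lra.
have B0 : 0 <= B by rewrite mulr_ge0 ?gap_bound_ge0// exprn_ge0// invr_ge0.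
have ogE y : (og y).1 = - (solve c ybar lam So y).1.2.
  by rewrite /og; case: solve => [[? ?] ?].
pose f y := ndual P c y + lam / 2 * enorm (y - ybar) ^+ 2.
pose g y := gndual P c y + lam *: (y - ybar).
have lamE : 2 * (lam / 2) = lam by field.
have lb : quad_lb (dY P) f g lam.
  have := quad_lb_addsq (lam / 2) ybar (ndual_lb hst Xc).
  by rewrite add0r lamE.
have lb0 := quad_lbW (ltW lam0) lb.
have ub : quad_ub (dY P) f g L.
  have := quad_ub_addsq (lam / 2) ybar (ndual_ub hst Xc).
  by rewrite lamE.
(* The error of the dual gradient caused by the inner solver, times Ry. *)
have xerr y : dY P y ->
    Lxy P * enorm ((solve c ybar lam So y).1.1 - regmin P c y) * Ry P <= rho.
  move=> Yy; have [_ _ h _] := solve_reg_dual_spec ybar lam So Xc Yy.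
  move: h; rewrite -/B; set a := enorm _ => h.
  have a0 : 0 <= a := enorm_ge0 _.
  rewrite -(@ler_pXn2r _ 2)// ?nnegrE ?mulr_ge0 ?(ltW Lc) ?(ltW hR)//.
  apply: le_trans hrho.
  have LE : Lyyp P - Lyy P = Lxy P ^+ 2 / Lxx P by rewrite /Lyyp addrC addKr.
  rewrite LE (_ : (Lxy P * a * Ry P) ^+ 2 =
    2 * (Lxy P ^+ 2 / Lxx P * Ry P ^+ 2) * (Lxx P / 2 * a ^+ 2)); last by field; lra.
  rewrite ler_wpM2l// mulr_ge0//.
  by apply: mulr_ge0; [apply: divr_ge0|]; rewrite ?sqr_ge0// ltW.
have solveE y : dY P y -> (solve c ybar lam So y).1.2 =
    grady P (solve c ybar lam So y).1.1 y - lam *: (y - ybar).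
  by move=> Yy; have [_ ->] := solve_reg_dual_spec ybar lam So Xc Yy.
have solveX y : dY P y -> dX P (solve c ybar lam So y).1.1.
  by move=> Yy; have [] := solve_reg_dual_spec ybar lam So Xc Yy.
have gerr y u w : dY P y -> dY P u -> dY P w ->
    dot (grady P (regmin P c y) y - grady P (solve c ybar lam So y).1.1 y) (u - w)
      <= 2 * rho.
  move=> Yy Yu Yw; apply: le_trans (diamY_dot hst _ Yu Yw) _.
  have [Xp _] := regminP hst Xc Yy.
  have := grady_lipx hst (solveX y Yy) Xp Yy; rewrite (enormB (regmin P c y)) => h.
  by have := ler_wpM2r (ltW hR) h; have := xerr y Yy; lra.
have og_err v u w : dY P v -> dY P u -> dY P w ->
    dot ((og v).1 - g v) (u - w) <= 2 * rho.
  move=> Yv Yu Yw; apply: le_trans (gerr v u w Yv Yu Yw).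
  rewrite ogE solveE// /g /gndual opprB opprD opprK.
  rewrite [X in dot X _ <= _](_ : _ = grady P (regmin P c v) v
     - grady P (solve c ybar lam So v).1.1 v)//.
  by apply/rowP => i; rewrite !mxE; ring.
have [yh yhmin] := quad_lb_argmin (compact_closed (@norm_hausdorff _ _) (Y_compact hst))
  (Y_convex hst) Yb lam0 lb.
have gam0 : 0 < 1 / L by rewrite divr_gt0.
have gamE : (1 / L)^-1 = L by rewrite div1r invrK.
have ub' := ub; rewrite -gamE in ub'.
have rho2 : 0 <= 2 * rho by lra.
have hq : 32 <= lam * (1 / L) * (T%:R * (T%:R + 3)).
  rewrite div1r mulrAC ler_pdivlMr//.
  by have : 0 <= T%:R :> R by []; nra.
have [Yy _ /(_ S0) hy] := @restart_rate _ _ _ f g (1 / L) (2 * rho) og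
  (compact_closed (@norm_hausdorff _ _) (Y_compact hst)) (Y_convex hst) gam0 lb0 ub'
  og_err lam yh ybar T S rho2 lam0 lb yhmin Yb T0 hq.
move=> y x; rewrite -/y in Yy hy.
have Xx : dX P x by exact: solveX.
have [_ _ _ /(_ So0) hx] := solve_reg_dual_spec ybar lam So Xc Yy.
have [Xp pmin] := regminP hst Xc Yy.
split => // [z Xz|th th01].
  by apply: le_trans hx _; rewrite lerD2r; exact: pmin.
have [y' Yy' [-> _]] := primal_attained hst Xx.
have h1 := obj_concave_ub hst Xx Yy Yy'.
set e := 8^-1 ^+ S * (2 * lam * Ry P ^+ 2) + 4 * rho.
have hS : 0 <= 8^-1 ^+ S :> R by rewrite exprn_ge0// invr_ge0.
have fe z : dY P z -> f y <= f z + e.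
  move=> Yz; have := yhmin.2 _ Yz.
  have h2 : enorm (ybar - yh) ^+ 2 <= (2 * Ry P) ^+ 2.
    rewrite ler_pXn2r ?nnegrE ?enorm_ge0//; last by lra.
    exact: diamY hst _ _ Yb yhmin.1.
  have lam2 : 0 <= lam / 2 by lra.
  have := ler_wpM2l hS (ler_wpM2l lam2 h2).
  have -> : lam / 2 * (2 * Ry P) ^+ 2 = 2 * lam * Ry P ^+ 2 by field.
  move: hy; rewrite /e; set V1 := _ * _; set V2 := _ * (2 * lam * _).
  move: (f y) (f z) (f yh) => fy fz fyh; clear; lra.
have h2 := approx_min_slope (Y_convex hst) ub Yy Yy' fe th01.
have h3 := gerr y y y' Yy Yy Yy'.
have h4 : lam * dot (y - ybar) (y' - y) <= 4 * lam * Ry P ^+ 2.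
  have := dot_le (y - ybar) (y' - y).
  have := diamY hst Yy Yb; have := diamY hst Yy' Yy.
  have := enorm_ge0 (y - ybar); have := enorm_ge0 (y' - y).
  set a := enorm _; set b := enorm _ => a0 b0 ha hb hd.
  have : b * a <= (2 * Ry P) * (2 * Ry P) by apply: ler_pM.
  by move=> /(le_trans hd)/(ler_wpM2l (ltW lam0)); lra.
have h5 : L / 2 * th * enorm (y' - y) ^+ 2 <= 2 * L * th * Ry P ^+ 2.
  rewrite (_ : 2 * L * th * Ry P ^+ 2 = L / 2 * th * (2 * Ry P) ^+ 2); last by field.
  have /andP[th0 _] := th01.
  rewrite ler_wpM2l ?mulr_ge0 ?(ltW th0) ?(ltW L0)// ?invr_ge0//.
  rewrite ler_pXn2r ?nnegrE ?enorm_ge0//; last by lra.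
  exact: diamY.
have h6 : dot (grady P x y) (y' - y) = - dot (g y) (y' - y)
    + lam * dot (y - ybar) (y' - y)
    + dot (grady P (regmin P c y) y - grady P x y) (y - y').
  by rewrite /g /gndual !dotE; ring.
rewrite -/x in h3; clear -h1 h2 h3 h4 h5 h6; lra.
Qed.

End Step.

(** * The Moreau envelope and the stationarity residual *)

Section Envelope.
Context {R : realType} {n m : nat}.
Variable P : minimax R n m.
Hypothesis hst : standing P.
Implicit Types (x z : 'rV[R]_n).

(** The primal function is a maximum of Lxx-weakly convex functions, so that
    the proximal term makes it Lxx-strongly convex. *)
Lemma primal_reg_lb xh : exists g,
  quad_lb (dX P) (fun x => primal P x + Lxx P * enorm (x - xh) ^+ 2) g (Lxx P).
Proof.
pose ys v := xget 0 [set y | dY P y /\ primal P v = obj P v y].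
have ysP v : dX P v -> dY P (ys v) /\ primal P v = obj P v (ys v).
  move=> Xv; apply: (@xgetPex _ 0 [set y | dY P y /\ primal P v = obj P v y]).
  by have [y Yy [pE _]] := primal_attained hst Xv; exists y.
exists (fun v => greg P xh (ys v) v) => u v Xu Xv.
have [Yy pE] := ysP v Xv.
have := hreg_lb hst xh Yy Xu Xv; have := obj_le_primal hst Xu Yy.
by rewrite /hreg pE; lra.
Qed.

Lemma primal_prox xh : dX P xh -> exists2 xp, dX P xp & forall x, dX P x ->
  primal P xp + Lxx P * enorm (xp - xh) ^+ 2 + Lxx P / 2 * enorm (x - xp) ^+ 2
    <= primal P x + Lxx P * enorm (x - xh) ^+ 2.
Proof.
move=> Xh; have [g lb] := primal_reg_lb xh.
have [xp xpmin] := quad_lb_argmin (X_closed hst) (X_convex hst) Xh (Lxx_gt0 hst) lb.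
exists xp; first exact: xpmin.1.
exact: quad_lb_growth (X_convex hst) lb xpmin.
Qed.

Lemma moreau_grad xh xp : dX P xh -> dX P xp -> (forall x, dX P x ->
  primal P xp + Lxx P * enorm (xp - xh) ^+ 2 + Lxx P / 2 * enorm (x - xp) ^+ 2
    <= primal P x + Lxx P * enorm (x - xh) ^+ 2) ->
  is_grad setT (moreau P (2 * Lxx P)) xh ((2 * Lxx P) *: (xh - xp)).
Proof.
move=> Xh Xp hp; have Lx := Lxx_gt0 hst.
pose M z := [set primal P x' + 2 * Lxx P / 2 * enorm (x' - z) ^+ 2 | x' in dX P].
have L2 : 2 * Lxx P / 2 = Lxx P by field.
have ub z : moreau P (2 * Lxx P) z <= primal P xp + Lxx P * enorm (xp - z) ^+ 2.
  apply: (@ge_inf _ (M z)); last by exists xp => //; rewrite L2.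
  exists (inf [set primal P x | x in dX P]) => _ [x Xx <-].
  have := phimin_le hst Xx; have := sqr_ge0 (enorm (x - z)).
  by rewrite L2 => /(mulr_ge0 (ltW Lx)); lra.
have lb z c : (forall x, dX P x -> c <= primal P x + Lxx P * enorm (x - z) ^+ 2) ->
    c <= moreau P (2 * Lxx P) z.
  move=> h; apply: lb_le_inf.
    by exists (primal P xh + 2 * Lxx P / 2 * enorm (xh - z) ^+ 2); exists xh.
  by move=> _ [x Xx <-]; rewrite L2; exact: h.
have sq x z : enorm (x - z) ^+ 2 = enorm (x - xh) ^+ 2
    - 2 * dot (x - xh) (z - xh) + enorm (z - xh) ^+ 2.
  by rewrite !enorm2 !dotE !(dotC xh) (dotC z x); ring.
have ME : moreau P (2 * Lxx P) xh = primal P xp + Lxx P * enorm (xp - xh) ^+ 2.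
  apply/eqP; rewrite eq_le ub/=; apply: lb => x Xx.
  have := hp x Xx; have := sqr_ge0 (enorm (x - xp)).
  by move=> /(mulr_ge0 (ltW Lx)); lra.
apply/is_gradP => e e0; exists (e / (2 * Lxx P)); first by rewrite divr_gt0//; lra.
move=> z _; rewrite ltr_pdivlMr; last by lra.
set N := enorm (z - xh) => hN.
have N0 : 0 <= N := enorm_ge0 _.
have gE : dot ((2 * Lxx P) *: (xh - xp)) (z - xh) =
    - (2 * Lxx P * dot (xp - xh) (z - xh)).
  by rewrite dotZl -opprB dotNl mulrN.
have up : moreau P (2 * Lxx P) z - moreau P (2 * Lxx P) xh
    - dot ((2 * Lxx P) *: (xh - xp)) (z - xh) <= Lxx P * N ^+ 2.
  by have := ub z; rewrite ME gE (sq xp) -/N; lra.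
have lo : - (Lxx P * N ^+ 2) <= moreau P (2 * Lxx P) z - moreau P (2 * Lxx P) xh
    - dot ((2 * Lxx P) *: (xh - xp)) (z - xh).
  rewrite ME gE.
  suff : primal P xp + Lxx P * enorm (xp - xh) ^+ 2
    - 2 * Lxx P * dot (xp - xh) (z - xh) - Lxx P * N ^+ 2 <= moreau P (2 * Lxx P) z.
    by lra.
  apply: lb => x Xx.
  have h1 := hp x Xx; rewrite (sq x) -/N.
  have : dot (x - xh) (z - xh) = dot (x - xp) (z - xh) + dot (xp - xh) (z - xh).
    by rewrite -dotDl subrKA.
  have := dot_le (x - xp) (z - xh); rewrite -/N.
  set a := enorm (x - xp) in h1 *; set d1 := dot (x - xp) _.
  move=> h2 ->.
  have : 0 <= Lxx P / 2 * (a - 2 * N) ^+ 2 by rewrite mulr_ge0 ?sqr_ge0//; lra.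
  have := ler_wpM2l (ltW Lx) h2; lra.
have : Lxx P * N ^+ 2 <= e * N by rewrite expr2 mulrA ler_wpM2r//; lra.
by rewrite ler_norml; lra.
Qed.

End Envelope.

Section Residual.
Context {R : realType} {n : nat}.
Implicit Types (D : set 'rV[R]_n) (x xi : 'rV[R]_n) (L : R).

Let model_le x xi L x' : 0 < L ->
  - dot xi (x' - x) - L / 2 * enorm (x' - x) ^+ 2 <= enorm xi ^+ 2 / (2 * L).
Proof.
move=> L0; have := dot_ge xi (x' - x); set a := enorm xi; set b := enorm (x' - x).
have : 0 <= (a - L * b) ^+ 2 / (2 * L) by rewrite divr_ge0 ?sqr_ge0//; lra.
have -> : (a - L * b) ^+ 2 / (2 * L) = a ^+ 2 / (2 * L) - a * b + L / 2 * b ^+ 2.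
  by field; lra.
lra.
Qed.

Lemma residual_ub D x xi L x' : 0 < L -> D x' ->
  2 * L * (- dot xi (x' - x) - L / 2 * enorm (x' - x) ^+ 2)
    <= residual D x xi L ^+ 2.
Proof.
move=> L0 Dx'; rewrite /residual.
set V := [set _ | _ in _].
have le : 2 * L * (- dot xi (x' - x) - L / 2 * enorm (x' - x) ^+ 2) <= 2 * L * sup V.
  rewrite ler_pM2l; last by lra.
  apply: ub_le_sup; last by exists x'.
  by exists (enorm xi ^+ 2 / (2 * L)) => _ [z _ <-]; exact: model_le.
apply: (le_trans le).
have [h|/ltW h] := leP 0 (2 * L * sup V); first by rewrite sqr_sqrtr.
exact: le_trans h (sqr_ge0 _).
Qed.

Lemma residual_le D x xi L c : 0 < L -> D x -> 0 <= c -> (forall x', D x' ->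
  - dot xi (x' - x) - L / 2 * enorm (x' - x) ^+ 2 <= c) ->
  residual D x xi L ^+ 2 <= 2 * L * c.
Proof.
move=> L0 Dx c0 h; rewrite /residual.
set V := [set _ | _ in _].
have Vc : sup V <= c.
  apply: ge_sup; first by exists (- dot xi (x - x) - L / 2 * enorm (x - x) ^+ 2); exists x.
  by move=> _ [z Dz <-]; exact: h.
have L2 : 0 < 2 * L by lra.
have [h0|/ltW h0] := leP 0 (2 * L * sup V); first by rewrite sqr_sqrtr// ler_pM2l.
by rewrite ler0_sqrtr// expr0n/= mulr_ge0// ltW.
Qed.

Lemma residual_setT x xi L : 0 < L -> residual setT x xi L = enorm xi.
Proof.
move=> L0; apply/eqP; rewrite -(@eqrXn2 _ 2)// ?enorm_ge0 ?sqrtr_ge0// eq_le.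
have cE : enorm xi ^+ 2 = 2 * L * (enorm xi ^+ 2 / (2 * L)) by field; lra.
apply/andP; split.
  rewrite cE; apply: residual_le => // [|x' _]; last exact: model_le.
  by rewrite divr_ge0 ?sqr_ge0//; lra.
have := @residual_ub setT x xi L (x - L^-1 *: xi) L0 I.
have -> : x - L^-1 *: xi - x = - L^-1 *: xi by rewrite addrAC subrr sub0r scaleNr.
rewrite dotZr -enorm2 enormZ exprMn real_normK ?num_real// sqrrN.
by apply: le_trans; rewrite le_eqVlt; apply/orP; left; apply/eqP; field; lra.
Qed.

End Residual.

(** * The accuracy guaranteed by the parameters *)

Section Accuracy.
Context {R : realType}.
Implicit Types (r : R) (k : nat).

Lemma least_posint_gt0 r : (0 < least_posint r)%N.
Proof. by rewrite /least_posint absz_gt0 gt_eqF// lt_max ltr01. Qed.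

Let least_posintE r : (least_posint r)%:R = (Num.max 1 (Num.ceil r))%:~R :> R.
Proof.
rewrite /least_posint -[LHS]/((Posz `|_|)%:~R) gez0_abs// le_max.
by rewrite ler01.
Qed.

Lemma least_posint_ge r : r <= (least_posint r)%:R.
Proof.
rewrite least_posintE; apply: le_trans (ceil_ge r) _.
by rewrite ler_int le_max lexx orbT.
Qed.

Lemma least_posint_le r : (least_posint r)%:R <= Num.max 1 (r + 1).
Proof.
rewrite least_posintE; have [h|h] := leP (Num.ceil r) 1.
  by rewrite le_max lexx.
rewrite le_max; apply/orP; right.
by have := ceilB1_lt r; rewrite intrD rmorphN/= => /ltW; lra.
Qed.

Lemma log2_le r k : 0 < r -> log2 r <= k%:R -> r <= 2 ^+ k.
Proof.
move=> r0; rewrite /log2 ler_pdivrMr; last by rewrite ln_gt0// ltr1n.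
rewrite mulrC mulr_natr -lnXn// ler_ln ?posrE// exprn_gt0//.
Qed.

(** Here p = 2 ^ So, N is the number of steps of a stage in y and dl the inner
    accuracy. With p ^ 2 above the prescribed threshold, p ^ (-3) D0 is small
    even though the bound D0 on the initial error may be of order Thp. This follows
    from p ^ 2 >= 1152 N ^ 6 and p ^ 2 E >= 108 (De + 2 E) N ^ 3. *)
Lemma inner_accuracy (E De Th Thp N dl p D0 : R) :
  0 < E -> 0 <= De -> 0 < Th -> Th < Thp -> 1 <= N ->
  40 * (Thp + E) <= E * N ^+ 2 ->
  0 < dl -> dl <= 8 * E -> dl <= Th / (2 * N ^+ 3) ->
  0 < p ->
  72 * (3 * De + 2 * Th + 6 * E) * (E^-1 + 2 * Thp / dl ^+ 2 + 1 / (12 * dl))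
    <= p ^+ 2 ->
  0 <= D0 -> D0 <= 81 * De + 168 * E + Thp ->
  D0 <= E * p ^+ 3 /\ 200 * N ^+ 4 * (Thp - Th) * D0 <= E ^+ 2 * p ^+ 3.
Proof.
move=> E0 De0 Th0 ThThp N1 hN dl0 dlE dlTh p0 hp D00 hD0.
have Thp0 : 0 < Thp by lra.
have N0 : 0 < N by lra.
have N3 : 0 < N ^+ 3 by rewrite exprn_gt0.
have dl2 : 0 < dl ^+ 2 by rewrite exprn_gt0.
have hQ : 72 * (3 * De + 2 * Th + 6 * E) * (2 * Thp / dl ^+ 2) <= p ^+ 2.
  apply: le_trans hp; rewrite ler_wpM2l//; first by lra.
  have i1 : 0 < E^-1 by rewrite invr_gt0.
  have i2 : 0 < 1 / (12 * dl) by rewrite divr_gt0//; lra.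
  lra.
have {}hQ : 144 * (3 * De + 2 * Th + 6 * E) * Thp <= p ^+ 2 * dl ^+ 2.
  by rewrite -ler_pdivrMr//; apply: le_trans hQ; rewrite le_eqVlt; apply/orP; left;
     apply/eqP; field; lra.
have {}dlTh : dl * (2 * N ^+ 3) <= Th by rewrite -ler_pdivlMr//; lra.
have F1 : 33 * N ^+ 3 <= p.
  have h1 : (dl * (2 * N ^+ 3)) ^+ 2 <= Th ^+ 2.
    by rewrite ler_pXn2r ?nnegrE// ?(ltW Th0)//; apply: ltW; rewrite !mulr_gt0.
  have h2 : 288 * Th ^+ 2 <= p ^+ 2 * dl ^+ 2.
    apply: le_trans hQ.
    have : Th * Th <= Th * Thp by rewrite ler_wpM2l ?(ltW Th0) ?(ltW ThThp).
    have : 0 <= De * Thp by rewrite mulr_ge0// ltW.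
    have : 0 <= E * Thp by rewrite mulr_ge0// ltW.
    by rewrite expr2; lra.
  have h3 : 288 * (dl * (2 * N ^+ 3)) ^+ 2 <= p ^+ 2 * dl ^+ 2 by lra.
  have h4 : 1152 * (N ^+ 3) ^+ 2 <= p ^+ 2.
    by rewrite -(ler_pM2r dl2); apply: le_trans h3; rewrite le_eqVlt; apply/orP; left;
     apply/eqP; ring.
  have N30 : 0 <= 33 * N ^+ 3 by rewrite mulr_ge0// ltW.
  rewrite -(@ler_pXn2r _ 2)// ?nnegrE// ?(ltW p0)// exprMn.
  by apply: le_trans h4; rewrite ler_wpM2r ?sqr_ge0//; lra.
have F2 : 108 * (De + 2 * E) * N ^+ 3 <= p ^+ 2 * E.
  have h1 : dl ^+ 2 * N ^+ 3 <= 4 * E * Thp.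
    have : dl * (dl * (2 * N ^+ 3)) <= (8 * E) * Th.
      by apply: ler_pM => //; rewrite ?(ltW dl0)// ?mulr_ge0// ltW.
    have : E * Th <= E * Thp by rewrite ler_wpM2l ?(ltW E0) ?(ltW ThThp).
    by rewrite expr2; lra.
  have h2 : 432 * (De + 2 * E) * Thp <= p ^+ 2 * dl ^+ 2.
    by apply: le_trans hQ; rewrite ler_wpM2r ?(ltW Thp0)//; lra.
  have h3 := ler_wpM2r (ltW N3) h2.
  have p2 : 0 <= p ^+ 2 by exact: sqr_ge0.
  have h4 := ler_wpM2l p2 h1.
  have Thp4 : 0 < 4 * Thp by lra.
  by rewrite -(ler_pM2r Thp4); lra.
set s := De + 2 * E in F2.
have s0 : 0 < s by rewrite /s; lra.
have w0 : 0 <= N ^+ 3 by exact: ltW.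
have G1 : 1080 * (N ^+ 6 * s) <= E * p ^+ 3.
  have h : 10 * N ^+ 3 * (108 * s * N ^+ 3) <= p * (p ^+ 2 * E).
    by apply: ler_pM => //; rewrite ?mulr_ge0 ?(ltW s0)//; lra.
  have -> : 1080 * (N ^+ 6 * s) = 10 * N ^+ 3 * (108 * s * N ^+ 3) by ring.
  by have -> : E * p ^+ 3 = p * (p ^+ 2 * E) by ring.
have G2 : 8 * N ^+ 9 <= p ^+ 3.
  have -> : 8 * N ^+ 9 = (2 * N ^+ 3) ^+ 3 by ring.
  by rewrite ler_pXn2r ?nnegrE ?mulr_ge0 ?(ltW p0)//; lra.
have pow k : 1 <= N ^+ k by exact: exprn_ege1.
have hThp : Thp <= N ^+ 2 * E / 40 by lra.
have hD0' : D0 <= 84 * s + Thp by rewrite /s; lra.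
split.
  apply: le_trans hD0' _.
  have : s <= N ^+ 6 * s by rewrite ler_peMl// ltW.
  have : E * (8 * N ^+ 9) <= E * p ^+ 3 by rewrite ler_pM2l.
  have : E * N ^+ 2 <= E * N ^+ 9.
    by rewrite ler_pM2l// ler_weXn2l.
  have : 0 < E * N ^+ 2 by rewrite mulr_gt0// exprn_gt0.
  lra.
have N4 : 0 <= 200 * N ^+ 4 by rewrite mulr_ge0// exprn_ge0// ltW.
have T1 : 200 * N ^+ 4 * (Thp - Th) * D0 <= 200 * N ^+ 4 * (N ^+ 2 * E / 40 * (84 * s + N ^+ 2 * E / 40)).
  rewrite -mulrA ler_wpM2l//; apply: ler_pM => //; lra.
apply: le_trans T1 _.
rewrite (_ : 200 * N ^+ 4 * _ = 420 * (E * (N ^+ 6 * s)) + E ^+ 2 * N ^+ 8 / 8); last by field.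
have h1 := ler_wpM2l (ltW E0) G1.
have E2 : 0 < E ^+ 2 by rewrite exprn_gt0.
have h2 := ler_wpM2l (ltW E2) G2.
have h3 : E ^+ 2 * N ^+ 8 <= E ^+ 2 * N ^+ 9 by rewrite ler_pM2l// ler_weXn2l.
have h4 : 0 < E ^+ 2 * N ^+ 8 by rewrite mulr_gt0// exprn_gt0.
have h5 : 0 < E * (N ^+ 6 * s) by rewrite !mulr_gt0// exprn_gt0.
rewrite expr2 in h2 h3 h4 *; lra.
Qed.

End Accuracy.

(** * Convergence *)

Section StepArithmetic.
Context {R : realType}.

(** The inner accuracy in the form used by one outer iteration. *)
Lemma inner_bounds (E De Th Thp N dl p D0 : R) :
  0 < E -> 0 < De -> 0 < Th -> Th < Thp -> 1 <= N ->
  40 * (Thp + E) <= E * N ^+ 2 ->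
  0 < dl -> dl <= 8 * E -> dl <= Th / (2 * N ^+ 3) ->
  0 < p ->
  72 * (3 * De + 2 * Th + 6 * E) * (E^-1 + 2 * Thp / dl ^+ 2 + 1 / (12 * dl))
    <= p ^+ 2 ->
  0 <= D0 -> D0 <= 81 * De + 168 * E + Thp ->
  let rho := E / (10 * N ^+ 2) in
  [/\ 0 <= rho, (p ^+ 3)^-1 * D0 <= E &
      2 * (Thp - Th) * ((p ^+ 3)^-1 * D0) <= rho ^+ 2].
Proof.
move=> E0 D0' Th0 hlt N1 hN d0 dE dTh p0 hp G0 G1 rho.
have [I1 I2] := inner_accuracy E0 (ltW D0') Th0 hlt N1 hN d0 dE dTh p0 hp G0 G1.
clear hp dTh dE.
have N0 : 0 < N by lra.
have N2 : 0 < N ^+ 2 by rewrite exprn_gt0.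
have p3 : 0 < p ^+ 3 by rewrite exprn_gt0.
split; first by rewrite divr_ge0 ?(ltW E0)// mulr_ge0// ltW.
  by rewrite mulrC ler_pdivrMr.
rewrite mulrCA mulrC ler_pdivrMr//.
have -> : rho ^+ 2 * p ^+ 3 = E ^+ 2 * p ^+ 3 / (100 * N ^+ 4).
  by rewrite /rho; field; rewrite gt_eqF.
rewrite ler_pdivlMr; last by rewrite mulr_gt0// exprn_gt0.
by apply: le_trans I2; rewrite le_eqVlt; apply/orP; left; apply/eqP; ring.
Qed.

(** The bound on phi(x_t) - F(x_t, y_t) obtained when y_t is moved towards the
    maximizer of F(x_t, .) by the fraction 1 / N ^ 2 of the way. *)
Lemma outer_bounds (E Thp N V lam L R2 rho : R) :
  0 < E -> 0 < Thp -> 1 <= N -> 40 * (Thp + E) <= E * N ^+ 2 -> V * N ^+ 2 <= 1 ->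
  lam * R2 = E -> L * R2 = Thp + E ->
  rho = E / (10 * N ^+ 2) ->
  (V * (2 * lam * R2) + 4 * rho) / (N ^+ 2)^-1 + 2 * L * (N ^+ 2)^-1 * R2
    + 4 * lam * R2 + 2 * rho <= 7 * E.
Proof.
move=> E0 Thp0 N1 hN hV hlam hL rhoE.
have N0 : 0 < N by lra.
have N2 : 0 < N ^+ 2 by rewrite exprn_gt0.
rewrite -[2 * lam * R2]mulrA -[4 * lam * R2]mulrA hlam invrK.
have -> : 2 * L * (N ^+ 2)^-1 * R2 = 2 * (L * R2) / N ^+ 2 by ring.
rewrite hL.
have -> : (V * (2 * E) + 4 * rho) * N ^+ 2 = V * N ^+ 2 * (2 * E) + 4 * E / 10.
  by rewrite rhoE; field; rewrite gt_eqF.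
have h1 : V * N ^+ 2 * (2 * E) <= 2 * E by rewrite ler_piMl//; lra.
have h2 : 2 * (Thp + E) / N ^+ 2 <= E / 20 by rewrite ler_pdivrMr//; lra.
have h3 : rho <= E / 10.
  rewrite rhoE ler_pdivrMr; last by rewrite mulr_gt0.
  have : 1 <= N ^+ 2 by exact: exprn_ege1.
  by move=> h; have := ler_wpM2l (ltW E0) h; lra.
lra.
Qed.

End StepArithmetic.

Section Convergence.
Context {R : realType} {n m : nat}.
Variables (P : minimax R n m) (x0 : 'rV[R]_n) (ybar : 'rV[R]_m) (epsx : R).
Hypotheses (hst : standing P) (Xx0 : dX P x0) (Yyb : dY P ybar).
Hypotheses (epsx0 : 0 < epsx) (gap0 : 0 < primal_gap P x0).

Let epsy : R := epsx ^+ 2 / (Lxx P * Ry P).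
Let q := std_parameters P x0 epsx epsy.

(** The accuracy E = epsx ^ 2 / Lxx = epsy Ry in function value, and the
    quantities Delta, Theta and Theta^+ that are compared with it. *)
Definition acc : R := epsx ^+ 2 / Lxx P.
Let E := acc.
Let De := primal_gap P x0.
Let Th := Lyy P * Ry P ^+ 2.
Let Thp := Lyyp P * Ry P ^+ 2.

(** The inner accuracy delta of the parameter choice. *)
Definition delta : R := Num.min (8 * epsy * Ry P)
  (Num.min (Th / (2 * (nTy q)%:R ^+ 3))
     (Num.sqrt (De * (Thp - Th) / ((nTx q)%:R * (nTy q)%:R ^+ 2)))).

(** The argument of the logarithm in the definition of the number of inner
    restarts. *)
Definition Qo : R := 72 * (3 * De + 2 * Th + 6 * epsy * Ry P) *
  (Lxx P / epsx ^+ 2 + 2 * Thp / delta ^+ 2 + 1 / (12 * delta)).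

Lemma nSyE : nSy q = least_posint (2 * log2 (Num.max (nTy q)%:R (Thp / delta))).
Proof. by []. Qed.

Lemma nSoE : nSo q = least_posint (1 / 2 * log2 Qo).
Proof. by []. Qed.

Lemma acc_gt0 : 0 < E.
Proof. by rewrite divr_gt0 ?exprn_gt0// (Lxx_gt0 hst). Qed.

Lemma epsyR : epsy * Ry P = E.
Proof.
by rewrite /E /acc /epsy; have := Lxx_gt0 hst; have := Ry_gt0 hst => *; field; lra.
Qed.

Lemma accV : Lxx P / epsx ^+ 2 = E^-1.
Proof. by rewrite /E /acc invf_div. Qed.

Lemma lam_yE : lam_y q * Ry P ^+ 2 = E.
Proof.
rewrite -epsyR /q /=; have := Ry_gt0 hst => *; field; lra.
Qed.

Lemma lam_y_gt0 : 0 < lam_y q.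
Proof.
have R2 : 0 < Ry P ^+ 2 by rewrite exprn_gt0// (Ry_gt0 hst).
by rewrite -(pmulr_lgt0 _ R2) lam_yE acc_gt0.
Qed.

Lemma Th_gt0 : 0 < Th.
Proof. by rewrite mulr_gt0 ?exprn_gt0 ?(Ry_gt0 hst) ?(Lyy_gt0 hst). Qed.

Lemma Th_lt : Th < Thp.
Proof. by rewrite ltr_pM2r ?Lyyp_gt// exprn_gt0// (Ry_gt0 hst). Qed.

Lemma nTx_gt0 : (0 < nTx q)%N. Proof. exact: least_posint_gt0. Qed.
Lemma nTy_gt0 : (0 < nTy q)%N. Proof. exact: least_posint_gt0. Qed.
Lemma nSy_gt0 : (0 < nSy q)%N. Proof. exact: least_posint_gt0. Qed.
Lemma nSo_gt0 : (0 < nSo q)%N. Proof. exact: least_posint_gt0. Qed.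

Let nTxE : nTx q = least_posint (10 * (De + 2 * E) / E).
Proof.
rewrite /q /=; congr least_posint; rewrite -/De -[2 * epsy * _]mulrA epsyR -accV.
by move: (De + 2 * E) => z; ring.
Qed.

Lemma nTx_bounds : 10 * (De + 2 * E) <= E * (nTx q)%:R <= 10 * De + 21 * E.
Proof.
have E0 := acc_gt0; have D0 := gap0; rewrite -/De in D0.
have h0 : 1 <= 10 * (De + 2 * E) / E.
  by rewrite ler_pdivlMr// -/E; lra.
apply/andP; split.
  by rewrite [leRHS]mulrC -ler_pdivrMr// nTxE least_posint_ge.
rewrite [leLHS]mulrC -ler_pdivlMr// nTxE; apply: le_trans (least_posint_le _) _.
rewrite ge_max; apply/andP; split.
  by rewrite ler_pdivlMr// -/E; lra.
by rewrite -lerBrDr le_eqVlt; apply/orP; left; apply/eqP; field; rewrite gt_eqF.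
Qed.

Lemma nTy_ge : 40 * (Lyyp P + lam_y q) <= lam_y q * (nTy q)%:R ^+ 2.
Proof.
have l0 := lam_y_gt0; have := Lyyp_gt hst; have := Lyy_gt0 hst => h1 h2.
rewrite [leRHS]mulrC -ler_pdivrMr//.
have h : 0 <= 40 * (Lyyp P + lam_y q) / lam_y q by rewrite divr_ge0//; lra.
rewrite -[X in X <= _](sqr_sqrtr h) ler_pXn2r ?nnegrE ?sqrtr_ge0//.
exact: least_posint_ge.
Qed.

Let N : R := (nTy q)%:R.

Lemma nTy_ge1 : 1 <= N. Proof. by rewrite ler1n nTy_gt0. Qed.

Lemma nTy_sqr : 40 * (Thp + E) <= E * N ^+ 2.
Proof.
have R2 : 0 < Ry P ^+ 2 by rewrite exprn_gt0// (Ry_gt0 hst).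
by have := ler_wpM2r (ltW R2) nTy_ge; rewrite -lam_yE -/N /Thp; lra.
Qed.

Lemma delta_gt0 : 0 < delta.
Proof.
have N1 := nTy_ge1; have T1 : 0 < (nTx q)%:R :> R by rewrite ltr0n nTx_gt0.
have hlt := Th_lt; have N0 : 0 < (nTy q)%:R :> R by rewrite ltr0n nTy_gt0.
rewrite /delta !lt_min -mulrA epsyR mulr_gt0 ?acc_gt0//=.
apply/andP; split; first by rewrite divr_gt0 ?Th_gt0// mulr_gt0// exprn_gt0.
by rewrite sqrtr_gt0 divr_gt0 ?mulr_gt0 ?exprn_gt0 ?gap0// subr_gt0.
Qed.

Lemma Qo_gt0 : 0 < Qo.
Proof.
have d0 := delta_gt0; have E0 := acc_gt0; have Th0 := Th_gt0; have hlt := Th_lt.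
have D0 := gap0; rewrite -/De in D0.
rewrite /Qo -[6 * _ * _]mulrA epsyR accV mulr_gt0//; first by rewrite -/E; lra.
have i1 : 0 < E^-1 by rewrite invr_gt0.
have i2 : 0 < 1 / (12 * delta) by rewrite divr_gt0//; lra.
have i3 : 0 < 2 * Thp / delta ^+ 2 by rewrite divr_gt0 ?exprn_gt0//; lra.
lra.
Qed.

Lemma pow_nSo : Qo <= (2 ^+ nSo q) ^+ 2.
Proof.
rewrite -exprM; apply: log2_le; first exact: Qo_gt0.
have := least_posint_ge (1 / 2 * log2 Qo); rewrite -nSoE natrM; lra.
Qed.

Lemma pow_nSy : 8^-1 ^+ nSy q * N ^+ 2 <= 1.
Proof.
have N1 := nTy_ge1; have N0 : 0 < N by lra.
have h : N ^+ 2 <= 2 ^+ nSy q.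
  apply: log2_le; first by rewrite exprn_gt0.
  apply: le_trans (least_posint_ge _); rewrite -/N.
  set M := Num.max _ _; have NM : N <= M by rewrite le_max lexx.
  have h : ln N / ln 2 <= ln M / ln 2.
    by rewrite ler_pM2r ?invr_gt0 ?ln_gt0 ?ltr1n// ler_ln ?posrE// (lt_le_trans N0).
  by rewrite /log2 lnXn// mulr2n; lra.
rewrite exprVn mulrC ler_pdivrMr ?exprn_gt0// mul1r; apply: le_trans h _.
by rewrite lerXn2r ?nnegrE// ler_nat.
Qed.

Lemma gap_bound_le c (t : nat) : (t <= nTx q)%N ->
  primal P c <= primal P x0 + 8 * E * t%:R ->
  gap_bound P c <= 81 * De + 168 * E + Thp.
Proof.
move=> tT hc.
have GE : gap_bound P c = primal P c - primal P x0 + De + (Thp - Th).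
  by rewrite /gap_bound /De /primal_gap /Thp /Th; ring.
have /andP[_ hT] := nTx_bounds; rewrite -/E in hT.
have ht : E * t%:R <= E * (nTx q)%:R by rewrite ler_pM2l ?acc_gt0// ler_nat.
have Th0 := Th_gt0; rewrite GE; move: hc hT ht Th0.
move: (primal P c) (primal P x0) (t%:R : R) ((nTx q)%:R : R) (E) (De) (Th) (Thp).
by move=> pc p0 tr Tr e d h hp; lra.
Qed.

(** An accurate outer iteration: the primal function and F nearly agree at
    (x_t, y_t), and x_t nearly minimizes the regularized problem. *)
Lemma accurate_step c (t : nat) : dX P c -> (t <= nTx q)%N ->
  primal P c <= primal P x0 + 8 * E * t%:R ->
  let y := (restart_fgm ybar (dY P) (gam_y q) (nTy q) (nSy q)
    (fun y => let: (_, gpsi, k) :=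
       solve_reg_dual P y c ybar (gam_x q) (lam_y q) (nTo q) (nSo q) in
       (- gpsi, k))).1 in
  let x := (solve_reg_dual P y c ybar (gam_x q) (lam_y q) (nTo q) (nSo q)).1.1 in
  [/\ dX P x, dY P y, forall z, dX P z -> hreg P c y x <= hreg P c y z + E &
      primal P x <= obj P x y + 7 * E].
Proof.
move=> Xc tT hc.
have p0 : 0 < 2 ^+ nSo q :> R by rewrite exprn_gt0.
have VE : 8^-1 ^+ nSo q = ((2 ^+ nSo q) ^+ 3)^-1 :> R.
  have -> : 8 = 2 ^+ 3 :> R by rewrite -natrX.
  by rewrite exprVn -!exprM mulnC.
have dE : delta <= 8 * E by rewrite -epsyR mulrA /delta ge_min lexx.
have dTh : delta <= Th / (2 * N ^+ 3) by rewrite /delta !ge_min lexx !orbT.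
have hQ := pow_nSo; rewrite /Qo -[6 * _ * _]mulrA epsyR accV in hQ.
have [rho0 hB hrho] := inner_bounds acc_gt0 gap0 Th_gt0 Th_lt nTy_ge1 nTy_sqr
  delta_gt0 dE dTh p0 hQ (gap_bound_ge0 hst Xc) (gap_bound_le tT hc).
have ThB : (Lyyp P - Lyy P) * Ry P ^+ 2 = Thp - Th by rewrite mulrBl.
rewrite -VE in hB hrho; rewrite -ThB in hrho.
have [] := outer_step hst Xc Yyb lam_y_gt0 nTy_gt0 nSy_gt0 nSo_gt0 nTy_ge rho0 hrho.
set y := (restart_fgm _ _ _ _ _ _).1 => Xx Yy hx hphi; split => //.
  by move=> z /hx /le_trans; apply; rewrite lerD2l.
have N2 : 0 < N ^+ 2 by rewrite exprn_gt0// ltr0n nTy_gt0.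
have th01 : 0 < (N ^+ 2)^-1 <= 1.
  by rewrite invr_gt0 N2 invf_le1// exprn_ege1// nTy_ge1.
apply: le_trans (hphi _ th01) _; rewrite lerD2l.
apply: (outer_bounds acc_gt0 (lt_trans Th_gt0 Th_lt) nTy_ge1 nTy_sqr pow_nSy lam_yE) => //.
by rewrite mulrDl lam_yE.
Qed.

Let xs := iter_x P q x0 ybar.
Let ys := iter_y P q x0 ybar.

Let outer_iterS t : let c := xs t in
  let y := (restart_fgm ybar (dY P) (gam_y q) (nTy q) (nSy q)
    (fun y => let: (_, gpsi, k) :=
       solve_reg_dual P y c ybar (gam_x q) (lam_y q) (nTo q) (nSo q) in
       (- gpsi, k))).1 in
  ys t.+1 = y /\
  xs t.+1 = (solve_reg_dual P y c ybar (gam_x q) (lam_y q) (nTo q) (nSo q)).1.1.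
Proof.
rewrite /xs /ys /iter_x /iter_y /=.
case: (outer_iter P q x0 ybar t) => [[c d] k] /=.
case: restart_fgm => y ky /=.
by case: solve_reg_dual => [[x gx] kx].
Qed.

(** The primal function may increase along the iterations, but by at most 8 E
    per step. *)
Lemma iterates t : (t <= nTx q)%N -> [/\ dX P (xs t),
    primal P (xs t) <= primal P x0 + 8 * E * t%:R &
  (t < nTx q)%N -> [/\ dX P (xs t.+1), dY P (ys t.+1),
    forall z, dX P z ->
      hreg P (xs t) (ys t.+1) (xs t.+1) <= hreg P (xs t) (ys t.+1) z + E,
    primal P (xs t.+1) <= obj P (xs t.+1) (ys t.+1) + 7 * E &
    primal P (xs t.+1) + Lxx P * enorm (xs t.+1 - xs t) ^+ 2
      <= primal P (xs t) + 8 * E]].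
Proof.
have step k : dX P (xs k) -> primal P (xs k) <= primal P x0 + 8 * E * k%:R ->
  (k < nTx q)%N -> [/\ dX P (xs k.+1), dY P (ys k.+1),
    forall z, dX P z ->
      hreg P (xs k) (ys k.+1) (xs k.+1) <= hreg P (xs k) (ys k.+1) z + E,
    primal P (xs k.+1) <= obj P (xs k.+1) (ys k.+1) + 7 * E &
    primal P (xs k.+1) + Lxx P * enorm (xs k.+1 - xs k) ^+ 2
      <= primal P (xs k) + 8 * E].
  move=> Xk hk kT; have [-> ->] := outer_iterS k.
  have [h1 h2 h3 h4] := accurate_step Xk (ltnW kT) hk; split => //.
  have := obj_le_primal hst Xk h2; have := h3 _ Xk.
  by move: h4; rewrite /hreg subrr enorm0 expr0n/= mulr0 addr0; lra.
elim: t => [|t IH] tT.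
  have h : primal P (xs 0%N) <= primal P x0 + 8 * E * 0%:R.
    by rewrite mulr0 addr0.
  by split => //; exact: step.
have [Xt ht /(_ tT)[X1 Y1 _ _ h]] := IH (ltnW tT).
have ht1 : primal P (xs t.+1) <= primal P x0 + 8 * E * t.+1%:R.
  have := mulr_ge0 (ltW (Lxx_gt0 hst)) (sqr_ge0 (enorm (xs t.+1 - xs t))).
  by rewrite -natr1; lra.
by split => //; exact: step.
Qed.

(** Otherwise every step would decrease the primal function by E, and there
    are more than Delta / E steps. *)
Lemma short_step : exists2 t, (t < nTx q)%N &
  Lxx P * enorm (xs t.+1 - xs t) ^+ 2 <= 9 * E.
Proof.
apply: contrapT => h.
have long t : (t < nTx q)%N -> 9 * E <= Lxx P * enorm (xs t.+1 - xs t) ^+ 2.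
  move=> tT; rewrite leNgt; apply/negP => /ltW h1; apply: h; by exists t.
have dec t : (t <= nTx q)%N -> primal P (xs t) + E * t%:R <= primal P x0.
  elim: t => [|t IH] tT; first by rewrite mulr0 addr0.
  have [_ _ /(_ tT)[_ _ _ _ h2]] := iterates (ltnW tT).
  by have := IH (ltnW tT); have := long t tT; rewrite -natr1; lra.
have := dec _ (leqnn _).
have [Xt _ _] := iterates (leqnn (nTx q)).
have := phimin_le hst Xt.
have /andP[h1 _] := nTx_bounds.
by have := acc_gt0; have := gap0; move: h1; rewrite /De /primal_gap -/E; lra.
Qed.

Let res t := residual (dX P) (xs t) (gradx P (xs t) (ys t)) (Lxx P).

Lemma residual_after_short_step t : (t < nTx q)%N ->
  Lxx P * enorm (xs t.+1 - xs t) ^+ 2 <= 9 * E ->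
  res t.+1 ^+ 2 <= 2 * Lxx P * (84 * E).
Proof.
move=> tT ht; have [Xt _ /(_ tT)[X1 Y1 hmin _ _]] := iterates (ltnW tT).
have hL := Lxx_gt0 hst; have E0 := acc_gt0; rewrite -/E in E0.
apply: residual_le => //; first lra.
move=> x' Xx'.
have th01 : 0 < (12^-1 : R) <= 1 by lra.
have := approx_min_slope (X_convex hst) (hreg_ub hst (xs t) Y1) X1 Xx' hmin th01.
rewrite /greg dotDl dotZl invrK.
have := dot_le (xs t.+1 - xs t) (x' - xs t.+1).
move: ht; set a := enorm (_ - xs t); set b := enorm (x' - _).
set d1 := dot (gradx _ _ _) _; set d2 := dot (_ - xs t) _ => ht h1.
have h2 : 2 * Lxx P * d2 <= 2 * Lxx P * (a * b) by rewrite ler_pM2l// mulr_gt0.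
have : 0 <= Lxx P * (8 * a - b) ^+ 2 by rewrite mulr_ge0 ?sqr_ge0// ltW.
by have : 0 <= Lxx P * b ^+ 2; [rewrite mulr_ge0 ?sqr_ge0// ltW | lra].
Qed.

Lemma output_argmin tau : is_output P q x0 ybar tau -> argmin_upto (nTx q) res tau.
Proof.
case=> [[XT [h1 h2]]|//]; split; first exact: h1.
move=> t ht.
by rewrite /res XT !residual_setT ?(Lxx_gt0 hst)//; exact: h2.
Qed.

Lemma output_envelope tau : is_output P q x0 ybar tau ->
  dX P (xs tau) /\
  exists2 g, is_grad setT (moreau P (2 * Lxx P)) (xs tau) g & enorm g <= 28 * epsx.
Proof.
move=> /output_argmin[/andP[tau1 tauT] taumin].
have hL := Lxx_gt0 hst; have E0 := acc_gt0; rewrite -/E in E0.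
have resE : res tau ^+ 2 <= 2 * Lxx P * (84 * E).
  have [t tT ht] := short_step.
  apply: le_trans (residual_after_short_step tT ht).
  rewrite ler_pXn2r ?nnegrE ?sqrtr_ge0//; exact: taumin.
case: tau tau1 tauT taumin resE => // t _ tT _ resE.
have [_ _ /(_ tT)[Xh Yh _ hphi _]] := iterates (ltnW tT).
split => //; have [xp Xp hp] := primal_prox hst Xh.
exists ((2 * Lxx P) *: (xs t.+1 - xp)).
  have h0 := moreau_grad hst Xh Xp hp. exact: h0.
have h1 := hp _ Xh; rewrite subrr enorm0 expr0n/= mulr0 addr0 in h1.
have h2 := obj_le_primal hst Xp Yh.
have h3 := obj_quad_lb_x hst Yh Xp Xh.
have h4 := residual_ub (xs t.+1) (gradx P (xs t.+1) (ys t.+1)) hL Xp.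
have h5 := le_trans h4 resE.
rewrite ler_pM2l in h5; last by rewrite mulr_gt0.
rewrite (enormB xp) in h1 h3 h5.
rewrite enormZ gtr0_norm ?mulr_gt0//.
set d := enorm _ in h1 h3 h5 *.
have h6 : Lxx P * d ^+ 2 <= 182 * E by lra.
have d0 : 0 <= d := enorm_ge0 _.
rewrite -(@ler_pXn2r _ 2)// ?nnegrE ?mulr_ge0 ?(ltW epsx0) ?(ltW hL)//.
have -> : (2 * Lxx P * d) ^+ 2 = 4 * Lxx P * (Lxx P * d ^+ 2) by ring.
apply: (@le_trans _ _ (4 * Lxx P * (182 * E))); first by rewrite ler_pM2l// mulr_gt0.
have -> : 4 * Lxx P * (182 * E) = 728 * epsx ^+ 2.
  by rewrite /E /acc; field; rewrite gt_eqF.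
by rewrite exprMn; have := sqr_ge0 epsx; lra.
Qed.

End Convergence.

(** * Oracle complexity *)

Section PolynomialBounds.
Context {R : realType}.
Variable X : R.
Hypothesis X2 : 2 <= X.
Implicit Types (x y : R) (i j : nat).

(** x is nonnegative and at most the i-th power of X. *)
Definition pbnd i x := 0 <= x <= X ^+ i.

Let X1 : 1 <= X. Proof. by have := X2; lra. Qed.

Lemma pbndW i j x : (i <= j)%N -> pbnd i x -> pbnd j x.
Proof.
move=> ij /andP[x0 xi]; apply/andP; split => //.
by apply: le_trans xi _; rewrite ler_weXn2l.
Qed.

Lemma pbndM i j x y : pbnd i x -> pbnd j y -> pbnd (i + j) (x * y).
Proof.
move=> /andP[x0 xi] /andP[y0 yj]; apply/andP; split; first exact: mulr_ge0.
by rewrite exprD ler_pM.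
Qed.

Lemma pbndD i j x y : pbnd i x -> pbnd j y -> pbnd (maxn i j).+1 (x + y).
Proof.
move=> /(pbndW (leq_maxl i j))/andP[x0 xi] /(pbndW (leq_maxr i j))/andP[y0 yj].
apply/andP; split; first exact: addr_ge0.
rewrite exprS; apply: (@le_trans _ _ (2 * X ^+ maxn i j)); first by lra.
by rewrite ler_wpM2r// exprn_ge0//; have := X2; lra.
Qed.

Lemma pbndX i x (k : nat) : pbnd i x -> pbnd (i * k) (x ^+ k).
Proof.
move=> /andP[x0 xi]; apply/andP; split; first exact: exprn_ge0.
by rewrite exprM lerXn2r// nnegrE// exprn_ge0//; have := X2; lra.
Qed.

Lemma pbnd_nat (k i : nat) : (k <= 2 ^ i)%N -> pbnd i k%:R.
Proof.
move=> ki; apply/andP; split => //.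
apply: (@le_trans _ _ ((2 ^ i)%:R)); first by rewrite ler_nat.
by rewrite natrX lerXn2r ?nnegrE//; have := X2; lra.
Qed.

Lemma pbnd_max i x y : pbnd i x -> pbnd i y -> pbnd i (Num.max x y).
Proof. by move=> hx hy; rewrite /Num.max; case: ifP. Qed.

Lemma pbnd_le i x y : 0 <= x -> x <= y -> pbnd i y -> pbnd i x.
Proof. by move=> x0 xy /andP[_ yi]; rewrite /pbnd x0 (le_trans xy yi). Qed.

Lemma pbnd_sqr i x : 0 <= x -> pbnd (i + i) (x ^+ 2) -> pbnd i x.
Proof.
move=> x0 /andP[_]; rewrite addnn -muln2 exprM /pbnd x0/= ler_pXn2r// nnegrE.
by rewrite exprn_ge0//; have := X2; lra.
Qed.

End PolynomialBounds.

Section Logarithms.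
Context {R : realType}.

Lemma ln2_ge : 2^-1 <= ln 2 :> R.
Proof.
have := @le_ln1Dx R (- 2^-1); have -> : 1 + - 2^-1 = 2^-1 :> R by field.
by rewrite lnV ?posrE// => h; have := h ltac:(lra); lra.
Qed.

Lemma log2_ub (x l : R) (i : nat) : 0 < x -> 0 <= l -> pbnd (expR l) i x ->
  log2 x <= 2 * i%:R * l.
Proof.
move=> x0 l0 /andP[_ h].
have ln20 : 0 < ln 2 :> R by have := ln2_ge; lra.
have h1 : ln x <= i%:R * l.
  by rewrite -[leRHS]expRK expRM_natl ler_ln ?posrE// exprn_gt0 ?expR_gt0.
rewrite /log2 ler_pdivrMr//; apply: le_trans h1 _.
have : 0 <= i%:R * l by rewrite mulr_ge0.
by have := ln2_ge; nra.
Qed.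

Lemma ln_abs_pbnd (x l : R) : 0 < x -> `|ln x| <= l ->
  pbnd (expR l) 1 x /\ pbnd (expR l) 1 x^-1.
Proof.
move=> x0; rewrite ler_norml /pbnd expr1 => /andP[h1 h2].
rewrite (ltW x0) invr_ge0 (ltW x0)/=.
rewrite -{1}(lnK x0) ler_expR h2; split => //.
by rewrite -[x^-1]lnK ?posrE ?invr_gt0// ler_expR lnV ?posrE//; lra.
Qed.

Lemma ln_pbnd (x l : R) : 0 < x -> ln x <= l -> pbnd (expR l) 1 x.
Proof.
move=> x0 h; rewrite /pbnd expr1 (ltW x0)/=.
by rewrite -{1}(lnK x0) ler_expR.
Qed.

End Logarithms.

Lemma cost_const_ge0 {R : realType} (c1 c2 : R) : 0 <= c1 -> 0 <= c2 ->
  0 <= 31 * 10 * (c1 * c2 + c2 + 1).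
Proof. by move=> h1 h2; have := mulr_ge0 h1 h2; lra. Qed.

(** The product of the bounds on the numbers of iterations. *)
Lemma cost_arith {R : realType} (c1 c2 mx my l Tx Ty Sy K : R) :
  1 <= l -> 1 <= Ty -> Tx <= 31 * mx -> Ty <= 10 * my -> Sy <= c1 * l ->
  K <= c2 * l -> 0 <= Tx -> 0 <= Sy -> 0 <= K ->
  Tx * (Sy * (Ty * K) + K) + Tx <=
    31 * 10 * (c1 * c2 + c2 + 1) * (mx * my) * l ^+ 2.
Proof.
move=> l1 Ty1 hTx hTy hSy hK Tx0 Sy0 K0.
have l0 : 0 <= l by lra.
have ll : l <= l ^+ 2 by rewrite expr2 ler_peMl.
have h1 : Sy * K <= c1 * c2 * l ^+ 2.
  by rewrite expr2 mulrACA; exact: ler_pM.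
have c20 : 0 <= c2 by rewrite -(@pmulr_lge0 _ l)//; lra.
have h2 : K <= c2 * l ^+ 2 by apply: le_trans hK _; rewrite ler_wpM2l.
have h3 : Sy * (Ty * K) + K + 1 <= Ty * (Sy * K + K + 1).
  have : 0 <= (Ty - 1) * (K + 1) by rewrite mulr_ge0//; lra.
  lra.
have h4 : Ty * (Sy * K + K + 1) <= 10 * my * ((c1 * c2 + c2 + 1) * l ^+ 2).
  apply: ler_pM => //; [lra| |lra].
  by have := mulr_ge0 Sy0 K0; lra.
have SK := mulr_ge0 Sy0 (mulr_ge0 (le_trans ler01 Ty1) K0).
have h5 : Tx * (Sy * (Ty * K) + K + 1) <=
    31 * mx * (10 * my * ((c1 * c2 + c2 + 1) * l ^+ 2)).
  apply: ler_pM => //; first lra.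
  exact: le_trans h3 h4.
apply: (@le_trans _ _ (Tx * (Sy * (Ty * K) + K + 1))).
  by rewrite le_eqVlt; apply/orP; left; apply/eqP; ring.
by apply: le_trans h5 _; rewrite le_eqVlt; apply/orP; left; apply/eqP; ring.
Qed.

Section Complexity.
Context {R : realType} {n m : nat}.
Variables (P : minimax R n m) (x0 : 'rV[R]_n) (ybar : 'rV[R]_m) (epsx : R).
Hypotheses (hst : standing P) (Xx0 : dX P x0) (Yyb : dY P ybar).
Hypotheses (epsx0 : 0 < epsx) (gap0 : 0 < primal_gap P x0).

Let epsy : R := epsx ^+ 2 / (Lxx P * Ry P).
Let q := std_parameters P x0 epsx epsy.
Let E := acc P epsx.
Let De := primal_gap P x0.
Let Th := Lyy P * Ry P ^+ 2.
Let Thp := Lyyp P * Ry P ^+ 2.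
Let tx := cplx_x P x0 epsx.
Let ty := cplx_y P epsy.
Let LF := log_factor P x0 epsx epsy.
Let Z := expR LF.
Let dl := delta P x0 epsx.

Lemma oracle_callsE :
  let k := (nSo q * 11 + 1)%N in
  oracle_calls P q x0 ybar = (nTx q * (nSy q * (nTy q * k) + k) + nTx q)%N.
Proof.
move=> k; rewrite /oracle_calls; congr (_ + _)%N.
elim: (nTx q) => [|t IH] //=.
move: IH; case: (outer_iter P q x0 ybar t) => [[c d] k0] /= ->.
set og := (fun y => let: (_, _, _) := _ in _).
have ogk y : (og y).2 = k.
  rewrite /og; have := solve_reg_dual_cost P c ybar (lam_y q) (nSo q) y.
  by case: solve_reg_dual => [[? ?] ?].
have := restart_cost (dY P) (gam_y q) ogk ybar (nTy q) (nSy q).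
case: restart_fgm => y ky /= ->.
have := solve_reg_dual_cost P c ybar (lam_y q) (nSo q) y.
by case: solve_reg_dual => [[? ?] ?] /= ->; rewrite mulSn -addnA addnC.
Qed.

Let E0 : 0 < E. Proof. exact: acc_gt0. Qed.
Let Thp0 : 0 < Thp. Proof. exact: lt_trans (Th_gt0 hst) (Th_lt hst). Qed.

Let epsy0 : 0 < epsy.
Proof. by rewrite divr_gt0 ?exprn_gt0// mulr_gt0 ?(Lxx_gt0 hst) ?(Ry_gt0 hst). Qed.

Lemma cplx_xE : tx = De / E.
Proof. by rewrite /tx /cplx_x /E /acc invf_div mulrA [Lxx P * _]mulrC. Qed.

Lemma cplx_y_sqr : ty ^+ 2 = Thp / E.
Proof.
have hL := Lxx_gt0 hst; have hR := Ry_gt0 hst; have hP := lt_trans (Lyy_gt0 hst) (Lyyp_gt hst).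
rewrite /ty /cplx_y sqr_sqrtr; last first.
  by apply: ltW; rewrite divr_gt0// mulr_gt0.
by rewrite /Thp /epsy /E /acc; field; rewrite !gt_eqF.
Qed.

Lemma cplx_x_gt0 : 0 < tx. Proof. by rewrite cplx_xE divr_gt0. Qed.

Lemma cplx_y_gt0 : 0 < ty.
Proof.
rewrite lt_neqAle eq_sym sqrtr_ge0 andbT.
by rewrite -sqrf_eq0 cplx_y_sqr gt_eqF// divr_gt0.
Qed.

(** The leading factor of the bound is the product of the two complexity
    factors. *)
Lemma leading_factor :
  De * Lxx P `^ (3 / 2) * Lyyp P `^ (1 / 2) * Ry P / epsx ^+ 3 = tx * ty.
Proof.
have hL := Lxx_gt0 hst; have hR := Ry_gt0 hst; have hP := lt_trans (Lyy_gt0 hst) (Lyyp_gt hst).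
have hty : ty = Num.sqrt (Lyyp P) * Num.sqrt (Lxx P) * (Ry P / epsx).
  have r0 : 0 <= Ry P / epsx by rewrite divr_ge0 ?ltW.
  rewrite /ty /cplx_y -[X in _ = _ * X](ger0_norm r0) -sqrtr_sqr -sqrtrM ?ltW// -sqrtrM.
    by congr Num.sqrt; rewrite /epsy; field; rewrite !gt_eqF.
  by rewrite mulr_ge0 ?ltW.
have -> : Lxx P `^ (3 / 2) = Lxx P * Num.sqrt (Lxx P).
  have -> : 3 / 2 = 1 + 2^-1 :> R by field.
  rewrite powRD ?gt_eqF ?implybT// powRr1 ?ltW// powR12_sqrt ?ltW//.
have -> : Lyyp P `^ (1 / 2) = Num.sqrt (Lyyp P).
  by rewrite div1r powR12_sqrt ?ltW.
rewrite hty cplx_xE /E /acc; field; rewrite !gt_eqF//.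
Qed.

Lemma mulr_max_inv (a : R) : 0 < a -> a * Num.max 1 a^-1 = Num.max 1 a.
Proof. by move=> a0; rewrite maxr_pMr ?ltW// mulr1 mulfV ?gt_eqF// maxC. Qed.

Let ratio1 : 1 < Lyyp P / Lyy P.
Proof. by rewrite ltr_pdivlMr ?mul1r ?(Lyyp_gt hst)// (Lyy_gt0 hst). Qed.

Let ratio2 : 1 < Lyyp P / (Lyyp P - Lyy P).
Proof.
by rewrite ltr_pdivlMr ?subr_gt0 ?(Lyyp_gt hst)// mul1r gtrDl oppr_lt0 (Lyy_gt0 hst).
Qed.

Lemma log_factor_ge1 : 1 <= LF.
Proof.
have := ln_gt0 ratio1; have := ln_gt0 ratio2.
by rewrite /LF /log_factor -!addrA lerDl => *; rewrite !addr_ge0// ltW.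
Qed.

Let Z2 : 2 <= Z.
Proof.
apply: le_trans (expR_ge1Dx LF).
by have := log_factor_ge1; move: LF => l; lra.
Qed.

Let logs : [/\ pbnd Z 1 tx, pbnd Z 1 tx^-1, pbnd Z 1 ty & pbnd Z 1 ty^-1] /\
  pbnd Z 1 (Lyyp P / Lyy P) /\ pbnd Z 1 (Lyyp P / (Lyyp P - Lyy P)).
Proof.
have h1 := ln_gt0 ratio1; have h2 := ln_gt0 ratio2.
have h3 := normr_ge0 (ln tx); have h4 := normr_ge0 (ln ty).
have LFE : LF = 1 + `|ln tx| + `|ln ty| + ln (Lyyp P / Lyy P)
   + ln (Lyyp P / (Lyyp P - Lyy P)) by [].
have [|a1 a2] := @ln_abs_pbnd _ tx LF cplx_x_gt0.
  by rewrite LFE; move: `|ln tx| `|ln ty| (ln _) (ln _) h1 h2 h3 h4 => a b c d; lra.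
have [|b1 b2] := @ln_abs_pbnd _ ty LF cplx_y_gt0.
  by rewrite LFE; move: `|ln tx| `|ln ty| (ln _) (ln _) h1 h2 h3 h4 => a b c d; lra.
split => //; split; apply: ln_pbnd; rewrite ?(lt_trans ltr01)// LFE;
  by move: `|ln tx| `|ln ty| (ln _) (ln _) h1 h2 h3 h4 => a b c d; lra.
Qed.

Lemma nTx_le : (nTx q)%:R <= 31 * Num.max 1 tx.
Proof.
have /andP[_ h] := nTx_bounds hst epsx0 gap0.
have {}h : (nTx q)%:R <= 10 * tx + 21.
  rewrite cplx_xE -(ler_pM2l E0) mulrDr mulrCA [E * (De / E)]mulrC divfK ?gt_eqF//.
  by rewrite [E * 21]mulrC.
apply: le_trans h _.
have : 1 <= Num.max 1 tx by rewrite le_max lexx.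
have : tx <= Num.max 1 tx by rewrite le_max lexx orbT.
by move: (Num.max 1 tx) (tx) => a b; lra.
Qed.

Lemma nTy_le : (nTy q)%:R <= 10 * Num.max 1 ty.
Proof.
have m1 : 1 <= Num.max 1 ty by rewrite le_max lexx.
have mt : ty <= Num.max 1 ty by rewrite le_max lexx orbT.
set M := Num.max 1 ty in m1 mt *.
apply: le_trans (least_posint_le _) _; rewrite ge_max; apply/andP; split.
  by move: (M) m1 => a; lra.
have -> : 40 * (Lyyp P + epsy / Ry P) / (epsy / Ry P) = 40 * (ty ^+ 2 + 1).
  rewrite cplx_y_sqr /Thp /E -(epsyR epsx hst) -/epsy.
  have hR := Ry_gt0 hst; have he := epsy0.
  by field; rewrite !gt_eqF.
have h : Num.sqrt (40 * (ty ^+ 2 + 1)) <= 9 * M.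
  have M9 : 0 <= 9 * M by move: (M) m1 => a; lra.
  rewrite -[leRHS](ger0_norm M9) -sqrtr_sqr ler_sqrt ?sqr_ge0//.
  have := cplx_y_gt0; move: (M) (ty) m1 mt => a b; nra.
by move: (M) (Num.sqrt _) m1 h => a b; lra.
Qed.

Let pbndTx : pbnd Z 6 (nTx q)%:R.
Proof.
have [[h _ _ _] _] := logs.
apply: pbnd_le nTx_le _ => //.
apply: (pbndM (i := 5) (j := 1)); first exact: (@pbnd_nat _ _ Z2 31).
by apply: pbnd_max => //; apply: (pbndW Z2 (leq0n 1)); rewrite /pbnd expr0 ler01 lexx.
Qed.

Let pbndTy : pbnd Z 5 (nTy q)%:R.
Proof.
have [[_ _ h _] _] := logs.
apply: pbnd_le nTy_le _ => //.
apply: (pbndM (i := 4) (j := 1)); first exact: (@pbnd_nat _ _ Z2 10).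
by apply: pbnd_max => //; apply: (pbndW Z2 (leq0n 1)); rewrite /pbnd expr0 ler01 lexx.
Qed.

Let Th0 : 0 < Th. Proof. exact: Th_gt0. Qed.
Let dl0 : 0 < dl. Proof. exact: delta_gt0. Qed.

Let ThpTh : Thp / Th = Lyyp P / Lyy P.
Proof.
by rewrite /Thp /Th; field; rewrite !gt_eqF ?(Ry_gt0 hst) ?(Lyy_gt0 hst).
Qed.

Let ThpThp : Thp / (Thp - Th) = Lyyp P / (Lyyp P - Lyy P).
Proof.
rewrite /Thp /Th -mulrBl; field.
by rewrite !gt_eqF ?subr_gt0 ?(Lyyp_gt hst) ?(Ry_gt0 hst).
Qed.

(** Theta^+ / delta is polynomially bounded in the quantities whose logarithms
    enter the logarithmic factor. *)
Let pbnd_delta : pbnd Z 17 (Thp / dl).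
Proof.
have [[htx htxV hty htyV] [r1 r2]] := logs.
have Tx0 : 0 < (nTx q)%:R :> R by rewrite ltr0n nTx_gt0.
have Ty0 : 0 < (nTy q)%:R :> R by rewrite ltr0n nTy_gt0.
have hd : 0 < Thp - Th by rewrite subr_gt0 (Th_lt hst).
have h1 : pbnd Z 17 (Thp / (8 * E)).
  have -> : Thp / (8 * E) = 8^-1 * ty ^+ 2.
    by rewrite cplx_y_sqr; field; rewrite gt_eqF.
  apply: (pbndW Z2 (i := 0 + 1 * 2)) => //.
  apply: pbndM; last exact: pbndX.
  by rewrite /pbnd expr0 invr_ge0 invf_le1 ?ler1n ?ltr0n// ler0n.
have h2 : pbnd Z 17 (Thp / (Th / (2 * (nTy q)%:R ^+ 3))).
  have -> : Thp / (Th / (2 * (nTy q)%:R ^+ 3)) =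
      (Thp / Th) * (2%:R * (nTy q)%:R ^+ 3).
    by field; rewrite !gt_eqF.
  rewrite ThpTh; apply: (pbndW Z2 (i := 1 + (1 + 5 * 3))) => //.
  by do 2 apply: pbndM => //; [exact: (@pbnd_nat _ _ Z2 2 1)|exact: pbndX].
set w := De * (Thp - Th) / ((nTx q)%:R * (nTy q)%:R ^+ 2).
have w0 : 0 < w by rewrite /w divr_gt0 ?mulr_gt0 ?exprn_gt0.
have h3 : pbnd Z 17 (Thp / Num.sqrt w).
  apply: (pbnd_sqr Z2); first by rewrite divr_ge0 ?ltW ?sqrtr_gt0.
  have -> : (Thp / Num.sqrt w) ^+ 2 =
      Thp / (Thp - Th) * ty ^+ 2 * tx^-1 * ((nTx q)%:R * (nTy q)%:R ^+ 2).
    rewrite exprMn exprVn sqr_sqrtr ?ltW// cplx_y_sqr cplx_xE /w.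
    by field; rewrite !gt_eqF.
  rewrite ThpThp; apply: (pbndW Z2 (i := 1 + 1 * 2 + 1 + (6 + 5 * 2))) => //.
  apply: pbndM; last by apply: pbndM => //; exact: pbndX.
  by apply: pbndM => //; apply: pbndM => //; exact: pbndX.
have dlE : dl = Num.min (8 * E) (Num.min (Th / (2 * (nTy q)%:R ^+ 3)) (Num.sqrt w)).
  by rewrite /dl /delta -mulrA (epsyR epsx hst).
by rewrite dlE /Num.min; case: ifP => _ //; case: ifP.
Qed.

Lemma nSy_le : (nSy q)%:R <= 69 * LF.
Proof.
have LF1 := log_factor_ge1.
rewrite (nSyE P x0 epsx); apply: le_trans (least_posint_le _) _.
set M := Num.max (nTy q)%:R _.
have Ty0 : 0 < (nTy q)%:R :> R by rewrite ltr0n nTy_gt0.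
have M0 : 0 < M by apply: lt_le_trans Ty0 _; rewrite /M le_max lexx.
have hM : pbnd Z 17 M.
  by apply: pbnd_max => //; exact: (pbndW Z2 (i := 5)).
have LF0 : 0 <= LF by move: (LF) LF1 => l; lra.
have := log2_ub M0 LF0 hM.
rewrite ge_max; move: (log2 M) (LF) LF1 => a l l1 h.
by apply/andP; split; lra.
Qed.

Lemma nSo_le : (nSo q)%:R <= 60 * LF.
Proof.
have LF1 := log_factor_ge1; have [[htx htxV hty htyV] _] := logs.
rewrite (nSoE P x0 epsx); apply: le_trans (least_posint_le _) _.
have Q0 : 0 < Qo P x0 epsx by exact: Qo_gt0.
have hQ : pbnd Z 59 (Qo P x0 epsx).
  have -> : Qo P x0 epsx = 72%:R * (3%:R * tx + 2%:R * (Th / E) + 6%:R) *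
    (1%:R + 2%:R * ((Thp / dl) ^+ 2 * ty^-1 ^+ 2) + 12^-1 * (Thp / dl * ty^-1 ^+ 2)).
    rewrite /Qo -[6 * _ * _]mulrA (epsyR epsx hst) (accV P epsx) exprVn cplx_y_sqr cplx_xE.
    by rewrite -/E -/dl -/De -/Th -/Thp; field; rewrite !gt_eqF.
  have c i k : (k <= 2 ^ i)%N -> pbnd Z i k%:R by exact: pbnd_nat.
  have hV : pbnd Z 2 (ty^-1 ^+ 2) by exact: (pbndX Z2 2 htyV).
  have h12 : pbnd Z 0 (12^-1 : R).
    by rewrite /pbnd expr0 invr_ge0 invf_le1 ?ler1n ?ltr0n// ler0n.
  have hTh : pbnd Z 2 (Th / E).
    apply: (pbnd_le (y := ty ^+ 2)); first by rewrite divr_ge0 ?ltW.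
      by rewrite cplx_y_sqr ler_pM2r ?invr_gt0// ltW// (Th_lt hst).
    exact: (pbndX Z2 2 hty).
  have h1 := pbndD Z2 (pbndD Z2 (pbndM (c 2 3 isT) htx) (pbndM (c 1 2 isT) hTh)) (c 3 6 isT).
  have h2 := pbndD Z2 (pbndD Z2 (c 0 1 isT)
    (pbndM (c 1 2 isT) (pbndM (pbndX Z2 2 pbnd_delta) hV)))
    (pbndM h12 (pbndM pbnd_delta hV)).
  by apply: (pbndW Z2 _ (pbndM (pbndM (c 7 72 isT) h1) h2)).
have LF0 : 0 <= LF by move: (LF) LF1 => l; lra.
have := log2_ub Q0 LF0 hQ.
rewrite ge_max; move: (log2 _) (LF) LF1 => a l l1 h.
by apply/andP; split; lra.
Qed.

(** The factors 31, 10 and 69 come from the outer iterations, the steps of a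
    stage and its restarts; one inner solve costs at most 661 = 11 * 60 + 1
    times the logarithmic factor. *)
Lemma oracle_calls_le : (oracle_calls P q x0 ybar)%:R <=
  31 * 10 * (69 * 661 + 661 + 1) * (Num.max 1 tx * Num.max 1 ty) * LF ^+ 2.
Proof.
rewrite oracle_callsE; set k := (_ * 11 + 1)%N.
have LF1 := log_factor_ge1.
have hk : k%:R <= 661 * LF.
  by rewrite natrD natrM; have := nSo_le; move: ((nSo q)%:R : R) (LF) LF1 => a b; lra.
have Ty1 : 1 <= (nTy q)%:R :> R by rewrite ler1n nTy_gt0.
clearbody k; rewrite natrD natrM natrD natrM natrM.
have H := cost_arith LF1 Ty1 nTx_le nTy_le nSy_le hk. exact: H.
Qed.

End Complexity.

Theorem mainTheorem2 (R : realType) :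
  exists (C : R) (k : nat), 0 < C /\
  forall (n m : nat) (P : minimax R n m) (x0 : 'rV[R]_n) (ybar : 'rV[R]_m)
    (epsx : R),
  standing P -> dX P x0 -> dY P ybar -> 0 < epsx -> 0 < primal_gap P x0 ->
  let epsy := epsx ^+ 2 / (Lxx P * Ry P) in
  let q := std_parameters P x0 epsx epsy in
  (forall tau, is_output P q x0 ybar tau ->
     let xhat := iter_x P q x0 ybar tau in
     dX P xhat /\
     exists2 g, is_grad setT (moreau P (2 * Lxx P)) xhat g
              & enorm g <= C * epsx) /\
  (oracle_calls P q x0 ybar)%:R <=
    C * (primal_gap P x0 * Lxx P `^ (3 / 2) * Lyyp P `^ (1 / 2) * Ry P
           / epsx ^+ 3)
      * (Num.max 1 (cplx_x P x0 epsx)^-1 * Num.max 1 (cplx_y P epsy)^-1)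
      * log_factor P x0 epsx epsy ^+ k.
Proof.
pose C0 : R := 31 * 10 * (69 * 661 + 661 + 1).
have C00 : 0 <= C0 by exact: cost_const_ge0 (ler0n _ _) (ler0n _ _).
exists (28 + C0), 2; split; first by rewrite ltr_pwDl.
move=> n m P x0 ybar epsx hst Xx0 Yyb epsx0 gap0 epsy q; split.
  move=> tau htau xhat.
  have [Xh [g gM gle]] := output_envelope hst Xx0 Yyb epsx0 gap0 htau.
  split => //; exists g => //; apply: le_trans gle _.
  by rewrite ler_pM2r// lerDl.
have tx0 := cplx_x_gt0 hst epsx0 gap0; have ty0 := cplx_y_gt0 hst epsx0.
rewrite (leading_factor x0 hst epsx0) -!(mulrA (28 + C0)).
rewrite -[X in _ <= _ * (X * _)]mulrACA !mulr_max_inv// mulrA.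
apply: le_trans (oracle_calls_le ybar hst epsx0 gap0) _.
rewrite ler_wpM2r ?sqr_ge0// ler_wpM2r ?lerDr// mulr_ge0//.
  by rewrite le_max ler01.
by rewrite le_max ler01.
Qed.
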